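(* Let $\underline\lambda$ be a Schubert problem on $G(a,b)$ with a composable partition $(\underline\mu,\underline\nu),\underline a,\underline b$, where $\underline\mu=(\mu^1,\dots,\mu^r)$, $\underline\nu=(\nu^1,\dots,\nu^s)$. Let $c,d$ be positive integers and let $\underline\rho=(\underline\alpha,\underline\beta,\underline\gamma)$ be a Schubert problem on $G(c,d)$ with $\underline\alpha=(\alpha^1,\dots,\alpha^r)$, $\underline\beta=(\beta^1,\dots,\beta^s)$, $\underline\gamma=(\gamma^1,\dots,\gamma^t)$. Then the composition $\underline\lambda\circ\underline\rho$ is a Schubert problem on $G(a+c,b+d)$ and \[\delta(\underline\lambda\circ\underline\rho)=\delta(\underline\lambda)\cdot\delta(\underline\rho).\]
   Context: Partitions are weakly decreasing finite sequences of positive integers (the empty/zero partition $\emptyset$ is allowed), $\lambda_i:=0$ beyond the length $\ell(\lambda)$, $|\lambda|=\sum\lambda_i$, $\subseteq$ is componentwise. $\Box_{a,b}$ is the partition with $a$ parts equal to $b$; $\mu+\nu$ has $k$-th part $\mu_k+\nu_k$; $(\mu,\nu)$ is the decreasing rearrangement of the concatenated parts of $\mu$ and $\nu$. $G(a,b)$ is the Grassmannian of $a$-planes in $\mathbb{C}^{a+b}$, with Schubert classes $\sigma_\lambda$ ($\lambda\subseteq\Box_{a,b}$) in its cohomology ring. A Schubert problem on $G(a,b)$ is a list $\underline\lambda=(\lambda^1,\dots,\lambda^r)$ of partitions $\lambda^i\subseteq\Box_{a,b}$ with $\sum_i|\lambda^i|=ab$; $\delta(\underline\lambda)$ is the coefficient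 of $\sigma_{\Box_{a,b}}$ in $\sigma_{\lambda^1}\cdots\sigma_{\lambda^r}$, equivalently the coefficient of the Schur function $S_{\Box_{a,b}}$ in $S_{\lambda^1}\cdots S_{\lambda^r}$ (this is the number of points in an intersection of Schubert varieties $\Omega_{\lambda^i}F^i_\bullet$ for general flags). A composable partition of a Schubert problem $\underline\lambda$ on $G(a,b)$ is a splitting of its list of conditions into two lists $\underline\mu=(\mu^1,\dots,\mu^r)$ and $\underline\nu=(\nu^1,\dots,\nu^s)$, together with nonnegative integers $\underline a=(a_1,\dots,a_r)$, $\underline b=(b_1,\dots,b_s)$ with $a_1+\dots+a_r=a$, $b_1+\dots+b_s=b$, $a_i\ge\ell(\mu^i)$ and $b_j\ge\nu^j_1$ for all $i,j$. Given this and a Schubert problem $\underline\rho=(\underline\alpha,\underline\beta,\underline\gamma)$ on $G(c,d)$ split into lists of lengths $r,s,t$ (entries may be $\emptyset$), the composition $\underline\lambda\circ\underline\rho$ is the list of partitions $(\Box_{a_1,d}+\mu^1,\alpha^1),\dots,(\Box_{a_r,d}+\mu^r,\alpha^r),\ (\Box_{c,b_1},\nu^1)+\beta^1,\dots,(\Box_{c,b_s},\nu^s)+\beta^s,\ \gamma^1,\dots,\gamma^t$. *)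

(* Defs.v *)
From HB Require Import structures.
From mathcomp Require Import all_boot all_order all_algebra.
From Stdlib Require Import ClassicalEpsilon.
Set Implicit Arguments. Unset Strict Implicit. Unset Printing Implicit Defensive.
Import Order.TTheory GRing.Theory Num.Theory.

(** * Partitions, represented as seq nat (weakly decreasing, positive parts).
    lambda_i := nth 0 lambda i (0 beyond the length). *)
Definition is_partition (l : seq nat) : bool :=
  sorted geq l && all (fun x => 0 < x) l.

Definition subp (l m : seq nat) : bool :=
  all (fun i => nth 0 l i <= nth 0 m i) (iota 0 (size l)).

Definition box (a b : nat) : seq nat := if b == 0 then [::] else nseq a b.

Definition padd (m n : seq nat) : seq nat :=
  [seq nth 0 m i + nth 0 n i | i <- iota 0 (maxn (size m) (size n))].

Definition pjoin (m n : seq nat) : seq nat := sort geq (m ++ n).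

Definition plen (l : seq nat) : nat := size l.
Definition pfirst (l : seq nat) : nat := nth 0 l 0.

Definition psize (l : seq nat) : nat := sumn l.

Definition schubert_problem (a b : nat) (ls : seq (seq nat)) : bool :=
  all (fun l => is_partition l && subp l (box a b)) ls
  && (sumn (map psize ls) == a * b).

(** * Schur polynomials in N variables, as coefficient functions on monomials
    (a monomial x^m is an exponent vector m : seq nat of size N). *)

Fixpoint seqs_below (len N : nat) : seq (seq nat) :=
  match len with
  | 0 => [:: [::]]
  | l.+1 => [seq x :: t | x <- iota 0 N, t <- seqs_below l N]
  end.

Fixpoint fillings (sh : seq nat) (N : nat) : seq (seq (seq nat)) :=
  match sh with
  | [::] => [:: [::]]
  | r :: sh' => [seq x :: t | x <- seqs_below r N, t <- fillings sh' N]
  end.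

Definition is_ssyt (T : seq (seq nat)) : bool :=
  all (sorted leq) T &&
  all (fun i => all (fun j => nth 0 (nth [::] T i) j < nth 0 (nth [::] T i.+1) j)
                    (iota 0 (size (nth [::] T i.+1))))
      (iota 0 (size T).-1).

Definition content (N : nat) (T : seq (seq nat)) : seq nat :=
  [seq count_mem i (flatten T) | i <- iota 0 N].

Definition kostka (N : nat) (l m : seq nat) : nat :=
  count (fun T => is_ssyt T && (content N T == m)) (fillings l N).

Definition poly := seq nat -> int.

Definition schur (N : nat) (l : seq nat) : poly := fun m => Posz (kostka N l m).

Fixpoint subvecs (m : seq nat) : seq (seq nat) :=
  match m with
  | [::] => [:: [::]]
  | x :: m' => [seq y :: t | y <- iota 0 x.+1, t <- subvecs m']
  end.

Definition vsub (m m1 : seq nat) : seq nat := [seq x.1 - x.2 | x <- zip m m1].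

Definition polymul (f g : poly) : poly :=
  fun m => (\sum_(m1 <- subvecs m) f m1 * g (vsub m m1))%R.

Definition poly1 : poly := fun m => if all (fun x => x == 0) m then 1%R else 0%R.

Definition polyprod (fs : seq poly) : poly := foldr polymul poly1 fs.

Fixpoint comps_f (fuel n : nat) : seq (seq nat) :=
  if n == 0 then [:: [::]] else
  match fuel with
  | 0 => [::]
  | f.+1 => flatten [seq [seq i :: t | t <- comps_f f (n - i)] | i <- iota 1 n]
  end.
Definition partitions_of (k : nat) : seq (seq nat) :=
  filter is_partition (comps_f k k).

Definition schur_expansion (N k : nat) (F : poly) (c : seq nat -> int) : Prop :=
  forall m, size m = N ->
    F m = (\sum_(nu <- partitions_of k) c nu * Posz (kostka N nu m))%R.

(** delta(ls) for a Schubert problem on G(a,b): coefficient of S_{Box_{a,b}}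
    in S_{l^1} ... S_{l^r}, computed with N = a*b >= degree variables
    (so the Schur polynomials of degree a*b are linearly independent). *)
Definition delta (a b : nat) (ls : seq (seq nat)) : int :=
  let N := a * b in
  epsilon (inhabits 0%R)
    (fun d => exists c, schur_expansion N (sumn (map psize ls))
                          (polyprod [seq schur N l | l <- ls]) c
                        /\ c (box a b) = d).

Definition compose (c d : nat) (as_ bs : seq nat) (mu nu alpha beta gamma : seq (seq nat))
  : seq (seq nat) :=
  [seq pjoin (padd (box x.1.1 d) x.1.2) x.2 | x <- zip (zip as_ mu) alpha]
  ++ [seq padd (pjoin (box c x.1.1) x.1.2) x.2 | x <- zip (zip bs nu) beta]
  ++ gamma.

Definition composable (a b : nat) (lam mu nu : seq (seq nat)) (as_ bs : seq nat) : Prop :=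
  perm_eq lam (mu ++ nu) /\
  size as_ = size mu /\ size bs = size nu /\
  sumn as_ = a /\ sumn bs = b /\
  (forall i, i < size mu -> plen (nth [::] mu i) <= nth 0 as_ i) /\
  (forall j, j < size nu -> pfirst (nth [::] nu j) <= nth 0 bs j).

(* Main.v *)
Require Import Defs.
From HB Require Import structures.
From mathcomp Require Import all_boot all_order all_algebra.
From mathcomp Require Import zify ring.
From Stdlib Require Import FunctionalExtensionality ClassicalEpsilon.

Set Implicit Arguments. Unset Strict Implicit. Unset Printing Implicit Defensive.
Import Order.TTheory GRing.Theory Num.Theory.

(** The ring of symmetric functions acts on integer combinations of partitions:
    multiplication by the complete functions adds horizontal strips ([Hop]), by the
    elementary ones vertical strips ([Eop]), and every Schur function is a polynomial in
    the former.  Hence the coefficients [lrc] of a product of Schur functions are invariant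
    under conjugation and satisfy box duality: the coefficient of a rectangle in a product
    [F * G] is the sum of [F_l * G_l'], with [l'] the complement of [l] in the rectangle.

    Split the variables into [x] ([d] of them) and [y].  The part of [s_l(x, y)] of highest
    degree in [x] is [s_top(x) s_rest(y)], where [top] is the first [d] rows of [l]; so the
    extremal coefficients of a product factor.

    Apply duality in the [a + c] by [b + d] box to the product of the conditions built from
    [mu, alpha] and the product of those built from [nu, beta, gamma].  Dominance shows that
    only partitions [l] consisting of the [a] by [d] rectangle, a partition [m] to its right
    and a partition [k] below it contribute.  For these, both coefficients are extremal (for
    the columns of the first product and the rows of the second) and factor, and the sum
    over [m] and [k] is the product of the dual expressions of the two intersection
    numbers. *)

(** * Partitions in a fixed square *)

(** Two models of symmetric functions are used because each tool is simple in only one of them.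
    Commutation, conjugation and duality come from bijections of strips, so they live on coefficient
    vectors indexed by the partitions in an [M] by [M] square, a finite type. Leading terms in a
    group of variables live on polynomials. The map [spoly] joins the models through the Pieri rule
    and linear independence. A coefficient of [Hop k v] at [n] involves only partitions inside [n],
    so commutation is exact in the square; the Pieri rule for polynomials also looks at larger
    partitions and holds up to degree [M]. Hence the bounds [sumn s <= M] and [psz n <= M], and in
    the end [M = (a + c) * (b + d)], the degree of the composed problem.

    The dominance step is a squeeze: the first product bounds the boxes in the first [a] rows of [l]
    from below, the second one, through the complement, bounds the boxes of [l] beyond column [d]
    from above. The bounds meet because the sizes of the [mu^i] and [nu^j] add up to [a * b].
    Likewise the total [c * d] makes both products extremal for the same inner partitions. *)

Section Ptn.
Variable M : nat.

Record ptn := Ptn {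
  ptn_val : {ffun 'I_M -> 'I_M.+1};
  _ : [forall i : 'I_M, forall j : 'I_M, (i <= j) ==> (ptn_val j <= ptn_val i)] }.

HB.instance Definition _ := [isSub for ptn_val].
HB.instance Definition _ := [Finite of ptn by <:].

Definition prow (l : ptn) (i : nat) : nat :=
  if insub i is Some j then nat_of_ord (ptn_val l j) else 0.
Coercion prow : ptn >-> Funclass.

Lemma prow_out (l : ptn) i : M <= i -> l i = 0.
Proof. by move=> le_Mi; rewrite /prow insubN // -leqNgt. Qed.

Lemma prow_max (l : ptn) i : l i <= M.
Proof. by rewrite /prow; case: insub => // j; rewrite -ltnS ltn_ord. Qed.

Lemma prow_dec (l : ptn) i j : i <= j -> l j <= l i.
Proof.
move=> le_ij; case: (leqP M j) => [/prow_out-> //|lt_jM].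
have lt_iM: i < M by exact: leq_ltn_trans lt_jM.
rewrite /prow !insubT; case: l => f /= /forallP/(_ (Ordinal lt_iM)).
by move=> /forallP/(_ (Ordinal lt_jM))/implyP; exact.
Qed.

Lemma prowS (l : ptn) i : l i.+1 <= l i.
Proof. exact: prow_dec. Qed.

Lemma ptnP (l m : ptn) : (forall i, i < M -> l i = m i) -> l = m.
Proof.
move=> eq_lm; apply: val_inj; apply/ffunP => i; apply: val_inj => /=.
by have := eq_lm i (ltn_ord i); rewrite /prow valK.
Qed.

Definition zero_fun : {ffun 'I_M -> 'I_M.+1} := [ffun=> ord0].

Fact ptn0_subproof :
  [forall i : 'I_M, forall j : 'I_M, (i <= j) ==> (zero_fun j <= zero_fun i)].
Proof. by apply/forallP => i; apply/forallP => j; rewrite !ffunE implybT. Qed.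

Definition ptn0 : ptn := Ptn ptn0_subproof.

(* Junk value [ptn0] when [f] is not a partition contained in the square. *)
Definition mkptn (f : nat -> nat) : ptn :=
  insubd ptn0 ([ffun i : 'I_M => inord (f i)] : {ffun 'I_M -> 'I_M.+1}).

Definition ptn_fun (f : nat -> nat) :=
  [/\ forall i, f i.+1 <= f i, f 0 <= M & f M = 0].

Lemma fun_dec (f : nat -> nat) i j :
  (forall i, f i.+1 <= f i) -> i <= j -> f j <= f i.
Proof.
move=> f_dec /subnKC <-; elim: (j - i) => [|k IHk]; first by rewrite addn0.
by rewrite addnS; apply: leq_trans (f_dec _) IHk.
Qed.

Lemma mkptnE (f : nat -> nat) : ptn_fun f -> forall i, mkptn f i = f i.
Proof.
case=> f_dec f0 fM i; case: (leqP M i) => [le_Mi|lt_iM].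
  by rewrite prow_out //; have := fun_dec f_dec le_Mi; rewrite fM leqn0 => /eqP.
have f_le k: f k < M.+1 by rewrite ltnS; apply: leq_trans f0; exact: fun_dec.
rewrite /prow insubT /mkptn /insubd insubT /=.
  by apply/forallP => j; apply/forallP => k; apply/implyP => ?;
     rewrite !ffunE !inordK //; exact: fun_dec.
by move=> ?; rewrite ffunE inordK.
Qed.

Lemma ptn0E i : ptn0 i = 0.
Proof. by rewrite /prow; case: insub => //= j; rewrite ffunE. Qed.

Lemma sum_ord_leq n m (f : nat -> nat) :
  n <= m -> \sum_(i < n) f i <= \sum_(i < m) f i.
Proof.
move=> le_nm; rewrite -!(big_mkord xpredT f) (big_cat_nat (leq0n n) le_nm) //=; exact: leq_addr.
Qed.

Lemma sum_ord_vanish n m (f : nat -> nat) :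
  (forall i, n <= i -> f i = 0) -> \sum_(i < m) f i <= \sum_(i < n) f i.
Proof.
move=> f0; have [/sum_ord_leq // | /ltnW le_nm] := leqP m n.
rewrite -!(big_mkord xpredT f) (big_cat_nat (leq0n n) le_nm) //= [X in _ + X]big_nat_cond.
by rewrite [X in _ + X]big1 ?addn0 // => i /andP[/andP[]]; move/f0.
Qed.

Lemma mul_sum_ord n k : n * k = \sum_(i < n) k.
Proof. by rewrite sum_nat_const card_ord. Qed.

Definition psz (l : ptn) : nat := \sum_(i < M) l i.

Lemma sum_shift (l : ptn) n : M <= n -> \sum_(i < n) l i = psz l.
Proof.
move=> le_Mn; apply/eqP; rewrite eqn_leq; apply/andP; split; last exact: sum_ord_leq.
by apply: sum_ord_vanish => i; exact: prow_out.
Qed.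

Lemma psz0 : psz ptn0 = 0.
Proof. by rewrite /psz big1 // => i _; rewrite ptn0E. Qed.

Lemma prow_leq_psz (l : ptn) i : 0 < l i -> i.+1 + l 0 <= (psz l).+1.
Proof.
move=> li; have lt_iM: i < M by rewrite ltnNge; apply/negP => /(@prow_out l) E; rewrite E in li.
have : \sum_(j < i.+1) l j <= psz l by exact: (@sum_ord_leq i.+1 M l).
rewrite big_ord_recl /= => le.
have : \sum_(j < i) 1 <= \sum_(j < i) l (bump 0 j).
  apply: leq_sum => j _; apply: leq_trans li _; apply: prow_dec.
  by rewrite /bump leq0n add1n ltn_ord.
rewrite sum1_card card_ord => le2.
by have := leq_trans (leq_add (leqnn (l 0)) le2) le; rewrite addSn ltnS addnC.
Qed.

Lemma prow0_leq_psz (l : ptn) : l 0 <= psz l.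
Proof. by case E: (l 0) => // ; rewrite -E; have := @prow_leq_psz l 0; lia. Qed.

Lemma psz_eq0 (l : ptn) : psz l = 0 -> l = ptn0.
Proof.
move=> E; apply: ptnP => i _; rewrite ptn0E; have := prow0_leq_psz l.
have := prow_dec l (leq0n i); lia.
Qed.

Definition hs (n m : ptn) : bool :=
  [forall i : 'I_M, (n i.+1 <= m i) && (m i <= n i)].
Definition vs (n m : ptn) : bool :=
  [forall i : 'I_M, (m i <= n i) && (n i <= (m i).+1)].

Lemma hsP (n m : ptn) :
  reflect (forall i, n i.+1 <= m i <= n i) (hs n m).
Proof.
apply: (iffP forallP) => [h i|h i]; last exact: h.
case: (ltnP i M) => [lt_iM|le]; first exact: (h (Ordinal lt_iM)).
by rewrite !prow_out // ltnW.
Qed.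

Lemma vsP (n m : ptn) :
  reflect (forall i, m i <= n i <= (m i).+1) (vs n m).
Proof.
apply: (iffP forallP) => [h i|h i]; last exact: h.
case: (ltnP i M) => [lt_iM|le]; first exact: (h (Ordinal lt_iM)).
by rewrite !prow_out.
Qed.

Lemma psz_le (n m : ptn) : (forall i, m i <= n i) -> psz m <= psz n.
Proof. by move=> h; apply: leq_sum => i _. Qed.

End Ptn.

Lemma sum_bij (R : nmodType) (T U : finType) (P : pred T) (Q : pred U)
    (f : T -> U) (g : U -> T) (F : T -> R) (G : U -> R) :
    (forall x, P x -> Q (f x) /\ g (f x) = x) ->
    (forall y, Q y -> P (g y) /\ f (g y) = y) ->
    (forall x, P x -> F x = G (f x)) ->
  (\sum_(x | P x) F x = \sum_(y | Q y) G y)%R.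
Proof.
move=> Pf Qg FG; rewrite (reindex_onto g f) => [|x /Pf[] //].
rewrite (eq_bigl Q); last first.
  move=> y; apply/andP/idP => [[/Pf[Qfg _] /eqP Ey]|/Qg[Pg Ey]]; last by rewrite Ey.
  by rewrite Ey in Qfg.
by apply: eq_bigr => y Qy; have [Pg Ey] := Qg y Qy; rewrite FG // Ey.
Qed.

Global Opaque mkptn.

(** * Strip operators *)

Section Strips.
Variable M : nat.
Local Notation P := (ptn M).
Local Notation V := (ptn M -> int).
Implicit Types (l m n k : P) (u v : V).

(** A vector [v] stands for the sum of [v l] times the Schur function of [l]. By the Pieri rules
    [Hop k] and [Eop k] multiply by the complete and the elementary function, and [Dop k] is the
    adjoint of [Hop k]. *)
Definition Hop (k : nat) (v : V) : V := fun n =>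
  (\sum_(m | hs n m && (psz n == psz m + k)%N) v m)%R.
Definition Eop (k : nat) (v : V) : V := fun n =>
  (\sum_(m | vs n m && (psz n == psz m + k)%N) v m)%R.
Definition Dop (k : nat) (v : V) : V := fun m =>
  (\sum_(n | hs n m && (psz n == psz m + k)%N) v n)%R.
Definition basis (l : P) : V := fun m => (m == l)%:R%R.

(* The partitions between [n] and [k] form a product of intervals; reversing
   each interval exchanges the two strip sizes. *)
Definition between (n k : P) (i : nat) : nat :=
  maxn (k i) (n i.+1) + (if i is j.+1 then minn (k j) (n i) else n 0).

Definition reflect_ptn (n k m : P) : P := mkptn M (fun i => between n k i - m i).

(** The lower endpoint of row [i] and the upper endpoint of row [i.+1] are the maximum and the
    minimum of the same pair [k i], [n i.+1]. *)
Lemma sum_between n k : \sum_(i < M) between n k i = psz n + psz k.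
Proof.
(* The upper endpoint of row [r] is the term still waiting for its partner. *)
have E r : \sum_(i < r) between n k i + (if r is j.+1 then minn (k j) (n r) else n 0)
    = \sum_(i < r) k i + \sum_(i < r.+1) n i.
  elim: r => [|r IHr]; first by rewrite !big_ord0 big_ord_recr big_ord0.
  rewrite big_ord_recr /= [in RHS]big_ord_recr [\sum_(i < r.+2) _]big_ord_recr /=.
  move: IHr; rewrite /between; move: (\sum_(i < r) _) => /= X.
  move: (\sum_(i < r) _) (\sum_(i < r.+1) _) => Y Z; lia.
have z : (if M is j.+1 then minn (k j) (n M) else n 0) = 0.
  have n0 : M = 0 -> n 0 = 0 by move=> M0; apply: prow_out; rewrite M0.
  move: n0 (prow_out n (leqnn M)); move: (prow n) (prow k) => f g.
  by case: (M) => [|j] /= => [-> //|_ ->]; rewrite minn0.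
by have := E M; rewrite z big_ord_recr /= prow_out // !addn0 addnC.
Qed.

Lemma between_bounds n k m : hs n m -> hs m k -> forall i,
  [/\ maxn (k i) (n i.+1) <= m i,
      m i <= (if i is j.+1 then minn (k j) (n i) else n 0) &
      (if i is j.+1 then minn (k j) (n i) else n 0) <= n i].
Proof.
move=> /hsP hnm /hsP hmk [|i].
  by have := hnm 0; have := hmk 0; split; lia.
by have := hnm i.+1; have := hmk i.+1; have := hmk i; split; lia.
Qed.

Lemma reflect_ptnE n k m : hs n m -> hs m k ->
  forall i, reflect_ptn n k m i = between n k i - m i.
Proof.
move=> hnm hmk; have b := between_bounds hnm hmk.
apply: mkptnE; split=> [i||].
- by have [] := b i; have [] := b i.+1; rewrite /between /=; case: (i) => [|j] /=; lia.
- by have [] := b 0; rewrite /between; have := prow_max n 0; lia.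
- have [? ? ?] := b M; have := prow_out n (leqnn M).
  by rewrite /between; lia.
Qed.

Lemma reflect_ptn_spec n k m : hs n m -> hs m k ->
  [/\ hs n (reflect_ptn n k m), hs (reflect_ptn n k m) k,
      psz (reflect_ptn n k m) + psz m = psz n + psz k &
      reflect_ptn n k (reflect_ptn n k m) = m].
Proof.
move=> hnm hmk; have b := between_bounds hnm hmk; have rE := reflect_ptnE hnm hmk.
have h1 : hs n (reflect_ptn n k m).
  by apply/hsP => i; rewrite rE /between; have [] := b i; case: (i) => [|j]; lia.
have h2 : hs (reflect_ptn n k m) k.
  apply/hsP => i; rewrite !rE /between; have [] := b i; have [] := b i.+1.
  by case: (i) => [|j]; lia.
split=> //.
  rewrite -(sum_between n k) /psz -big_split /=; apply: eq_bigr => i _.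
  by rewrite rE; have [] := b i; rewrite /between; lia.
apply: ptnP => i _; rewrite reflect_ptnE // rE.
by have [] := b i; rewrite /between; lia.
Qed.

(** For fixed ends [n] and [k], reflecting the middle partition exchanges the chains with strip
    sizes [i], [j] and those with sizes [j], [i]. *)
Lemma Hop_comm i j v : Hop i (Hop j v) = Hop j (Hop i v).
Proof.
apply: functional_extensionality => n; rewrite /Hop.
rewrite (exchange_big_dep xpredT) //= [RHS](exchange_big_dep xpredT) //=; apply: eq_bigr => k _.
apply: (@sum_bij _ _ _ _ _ (reflect_ptn n k) (reflect_ptn n k)) => // m;
  move=> /andP[/andP[hnm /eqP E1] /andP[hmk /eqP E2]];
  have [h1 h2 E3 E4] := reflect_ptn_spec hnm hmk; split=> //; rewrite h1 h2 /=; lia.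
Qed.

Lemma hsxx n : hs n n.
Proof. by apply/hsP => i; rewrite leqnn prowS. Qed.

Lemma vsxx n : vs n n.
Proof. by apply/vsP => i; rewrite leqnn leqnSn. Qed.

Lemma sub_psz_eq m n : (forall i, m i <= n i) -> psz m = psz n -> m = n.
Proof.
move=> le_mn E; apply: ptnP => i lt_iM; apply/eqP; rewrite eqn_leq le_mn /=.
rewrite leqNgt; apply/negP => lt.
suff: psz m < psz n by rewrite E ltnn.
rewrite /psz (bigD1 (Ordinal lt_iM)) //= [X in _ < X](bigD1 (Ordinal lt_iM)) //=.
by rewrite -addSn leq_add // leq_sum.
Qed.

Lemma Hop0 v : Hop 0 v = v.
Proof.
apply: functional_extensionality => n; rewrite /Hop (big_pred1 n) // => m.
apply/andP/eqP => [[/hsP h /eqP E]|->]; last by rewrite hsxx addn0.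
by apply: sub_psz_eq => [i|]; [case/andP: (h i) | rewrite E addn0].
Qed.

Lemma Eop0 v : Eop 0 v = v.
Proof.
apply: functional_extensionality => n; rewrite /Eop (big_pred1 n) // => m.
apply/andP/eqP => [[/vsP h /eqP E]|->]; last by rewrite vsxx addn0.
by apply: sub_psz_eq => [i|]; [case/andP: (h i) | rewrite E addn0].
Qed.

Lemma Hop_lin (k : nat) (c : int) u v :
  Hop k (fun n => c * u n + v n)%R = (fun n => c * Hop k u n + Hop k v n)%R.
Proof.
by apply: functional_extensionality => n; rewrite /Hop big_split /= mulr_sumr.
Qed.

(* Toggling the last row in which [l] and [n] differ reverses the sign. *)
Lemma sum_sign_HE n l : n != l ->
  (\sum_(m | hs n m && vs m l) (-1) ^+ (psz m) = 0 :> int)%R.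
Proof.
move=> ne_nl; pose A := [pred m | hs n m && vs m l].
case: (pickP A) => [m0 /andP[hnm0 vm0l]|A0]; last first.
  by rewrite big_pred0 // => m; exact: A0.
have le_ln i : l i <= n i.
  by move/hsP: hnm0 => /(_ i); move/vsP: vm0l => /(_ i); lia.
have ex : exists i, (i < M) && (l i < n i).
  have [/existsP[i lti]|h] := boolP [exists i : 'I_M, l i < n i].
    by exists i; rewrite ltn_ord.
  case/eqP: ne_nl; apply: ptnP => i lt_iM; apply/eqP; rewrite eqn_leq le_ln andbT leqNgt.
  by move: h; rewrite negb_exists => /forallP/(_ (Ordinal lt_iM)).
have [i /andP[lt_iM lt_i] i_max] := ex_maxnP ex (fun i h => ltnW (andP h).1).
have eq_gt : n i.+1 = l i.+1.
  apply/eqP; rewrite eqn_leq le_ln andbT leqNgt; apply/negP => lt.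
  suff: i.+1 <= i by rewrite ltnn.
  apply: i_max; rewrite lt andbT ltnNge; apply/negP => le.
  by rewrite !prow_out in lt.
(* Row [i] of [m] is [l i] or [(l i).+1], and [tg] swaps the two values. Both are admissible:
   [l i < n i] leaves room above, and [n i.+1 = l i.+1] leaves room below. *)
pose tg (m : P) := mkptn M (fun j => if j == i then (l i).*2.+1 - m i else m j).
have tgE m : A m -> forall j, tg m j = if j == i then (l i).*2.+1 - m i else m j.
  move=> /andP[/hsP hnm /vsP vml]; apply: mkptnE; split=> [j||].
  - have := hnm j; have := hnm j.+1; have := vml j; have := vml j.+1.
    have := prowS m j; have := prowS l j.
    have := vml i; have := hnm i; have := lt_i; have := eq_gt.
    by case: (j.+1 =P i) => [->|_]; case: (j =P i) => [->|_]; lia.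
  - case: (0 =P i) => [E0|_]; last exact: prow_max.
    by have := vml i; have := hnm i; have := prow_max n i; lia.
  - by case: (M =P i) => [E|_]; [lia | rewrite prow_out].
have tgA m : A m -> A (tg m).
  move=> Am; have := tgE m Am; case/andP: Am => /hsP hnm /vsP vml E.
  apply/andP; split; [apply/hsP|apply/vsP] => j; rewrite E;
    by have := hnm j; have := vml j; have := prowS l i; case: (j =P i) => [->|_]; lia.
have tgK m : A m -> tg (tg m) = m.
  move=> Am; apply: ptnP => j _; rewrite tgE ?tgA // !tgE // eqxx.
  by case: (j =P i) => [->|//]; case/andP: Am => _ /vsP/(_ i); lia.
have tg_sz m : A m -> odd (psz (tg m)) = ~~ odd (psz m).
  move=> Am; rewrite /psz (bigD1 (Ordinal lt_iM)) //= [in RHS](bigD1 (Ordinal lt_iM)) //= !oddD tgE // eqxx.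
  rewrite (eq_bigr (fun j : 'I_M => m j)); last first.
    by move=> j ne; rewrite tgE // ifN.
  by case/andP: Am => _ /vsP/(_ i) bd; rewrite -addNb; congr (_ (+) _); lia.
have E : (\sum_(m | A m) (-1) ^+ psz m = - \sum_(m | A m) (-1) ^+ psz m :> int)%R.
  rewrite -sumrN; apply: (@sum_bij _ _ _ _ _ tg tg) => m Am.
  - by rewrite tgA ?tgK.
  - by rewrite tgA ?tgK.
  by rewrite -signr_odd -[in RHS]signr_odd tg_sz //; case: odd.
move: E; rewrite (_ : (\sum_(m | A m) _)%R = (\sum_(m | hs n m && vs m l) (-1) ^+ psz m)%R) //.
by move: (bigop _ _ _) => X; lia.
Qed.

(** The coefficient of [v l] at [n] is an alternating count of the partitions between them, which
    [sum_sign_HE] kills unless [n = l]. *)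
Lemma newton_HE (k : nat) v :
  (fun n => \sum_(i < k.+1) (-1) ^+ i * Hop (k - i) (Eop i v) n)%R
  = (fun n => (k == 0)%:R * v n)%R.
Proof.
apply: functional_extensionality => n.
(* The index [i] is the strip size [psz m - psz l], so its sign is the product of the signs of
   [psz l] and [psz m]. *)
transitivity (\sum_l (if psz n == psz l + k then
     (-1) ^+ psz l * (\sum_(m | hs n m && vs m l) (-1) ^+ psz m) * v l else 0) : int)%R.
  under eq_bigr => i _ do rewrite /Hop /Eop mulr_sumr.
  under eq_bigr => i _ do under eq_bigr => m _ do rewrite mulr_sumr.
  under eq_bigr => i _ do rewrite (exchange_big_dep xpredT) //=.
  rewrite exchange_big /=; apply: eq_bigr => l _.
  under eq_bigr => i _ do rewrite big_mkcond /=.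
  rewrite exchange_big /=.
  transitivity (\sum_m (if (psz n == psz l + k) && (hs n m && vs m l)
      then (-1) ^+ psz l * (-1) ^+ psz m * v l else 0) : int)%R; last first.
    case: eqP => _ /=; last by rewrite big1.
    by rewrite -big_mkcond /= mulr_sumr mulr_suml.
  apply: eq_bigr => m _.
  case: ifP => [/andP[/eqP En /andP[hnm vml]]|nc]; last first.
    rewrite big1 // => i _; case: ifP => // /andP[/andP[hnm /eqP E1] /andP[vml /eqP E2]].
    move: nc; rewrite hnm vml !andbT => /eqP[]; have := ltn_ord i; lia.
  have le1 : psz l <= psz m by apply: psz_le => i; case/andP: (vsP _ _ vml i).
  have le2 : psz m <= psz n by apply: psz_le => i; case/andP: (hsP _ _ hnm i).
  have lt : psz m - psz l < k.+1 by lia.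
  rewrite (bigD1 (Ordinal lt)) //= big1 ?addr0 => [|i /eqP ne]; last first.
    case: ifP => // /andP[/andP[_ /eqP E1] /andP[_ /eqP E2]].
    by case: ne; apply: val_inj => /=; lia.
  rewrite hnm vml /= !ifT; last by apply/andP; split; apply/eqP; lia.
  congr (_ * _)%R; rewrite -exprD -signr_odd -[RHS]signr_odd; congr (_ ^+ nat_of_bool _)%R.
  by rewrite oddB // oddD addbC.
rewrite (bigD1 n) //= [X in (_ + X)%R]big1 ?addr0 => [|l ne]; last first.
  by rewrite sum_sign_HE ?mulr0 ?mul0r ?if_same // eq_sym.
rewrite -{1}[psz n]addn0 eqn_add2l eq_sym; case: eqP => _; last by rewrite mul0r.
rewrite (big_pred1 n) => [|m]; first by rewrite -exprD addnn -signr_odd odd_double.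
apply/andP/eqP => [[/hsP h1 /vsP h2]|->]; last by rewrite hsxx vsxx.
by apply: ptnP => i _; have := h1 i; have := h2 i; lia.
Qed.

End Strips.

(** * Commutation of adding and removing horizontal strips *)

Section LocalRule.
Variable M : nat.
Local Notation P := (ptn M).
Local Notation V := (ptn M -> int).
Implicit Types (l m n q : P) (u v : V).

Lemma sum_recl r (f : nat -> nat) :
  \sum_(i < r.+1) f i = f 0 + \sum_(i < r) f i.+1.
Proof. by rewrite big_ord_recl; congr (_ + _); apply: eq_bigr. Qed.

(** A nonzero entry at [M] would force [M.+1] positive entries and a sum above [M]. Thus a bound on
    the size alone keeps a partition in the square. *)
Lemma ptn_fun_sum (f : nat -> nat) :
  (forall i, f i.+1 <= f i) -> \sum_(i < M.+1) f i <= M -> ptn_fun M f.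
Proof.
move=> f_dec le_fM; split=> //.
  by apply: leq_trans le_fM; rewrite big_ord_recl leq_addr.
apply/eqP; rewrite -leqn0 leqNgt; apply/negP => fM; move: le_fM; apply/negP.
rewrite -ltnNge -{1}(card_ord M.+1) -sum1_card; apply: leq_sum => i _.
by apply: leq_trans fM _; apply: fun_dec; rewrite // -ltnS.
Qed.

Lemma sum_maxmin l q :
  maxn (l 0) (q 0) + \sum_(i < M) (maxn (l i.+1) (q i.+1) + minn (l i) (q i))
  = psz q + psz l.
Proof.
rewrite big_split /= addnA -(sum_recl M (fun i => maxn (l i) (q i))).
rewrite big_ord_recr /= !(prow_out _ (leqnn M)) addn0 /psz -!big_split /=.
by apply: eq_bigr => i _; lia.
Qed.

(** The excess over the union of [q] and [l] in row [i.+1] equals the excess of their intersection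
    over [m] in row [i]; the first row receives the [y] free boxes. *)
Definition up_fun q l y m (i : nat) : nat :=
  if i is j.+1 then maxn (l i) (q i) + minn (l j) (q j) - m j
  else maxn (l 0) (q 0) + y.

Definition up_ptn q l y m : P := mkptn M (up_fun q l y m).

(** The same equations solved for [m]. The first row of [n] does not enter; it is recovered from
    [y]. *)
Definition down_ptn q l n : P :=
  mkptn M (fun i => maxn (l i.+1) (q i.+1) + minn (l i) (q i) - n i.+1).

Lemma up_ptnE q l y m : hs q m -> hs l m -> psz q + psz l + y <= psz m + M ->
  (forall i, up_ptn q l y m i = up_fun q l y m i) /\
  psz (up_ptn q l y m) + psz m = psz q + psz l + y.
Proof.
move=> /hsP hq /hsP hl le_M.
have E : \sum_(i < M.+1) up_fun q l y m i + psz m = psz q + psz l + y.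
  rewrite sum_recl /= -addnA -big_split /=.
  transitivity (maxn (l 0) (q 0) + y + \sum_(i < M) (maxn (l i.+1) (q i.+1) + minn (l i) (q i))).
    congr (_ + _); apply: eq_bigr => i _; rewrite subnK //.
    by have := hq i; have := hl i; lia.
  by rewrite addnAC sum_maxmin.
have fE : forall i, up_ptn q l y m i = up_fun q l y m i.
  apply: mkptnE; apply: ptn_fun_sum => [i|]; last by lia.
  rewrite /up_fun; have := hq i; have := hl i; case: (i) => [|j]; first by lia.
  by have := hq j; have := hl j; lia.
split=> //; rewrite -E; congr (_ + _); rewrite -(@sum_shift M _ M.+1) //.
exact: eq_bigr.
Qed.

Lemma down_ptnE q l n : hs n q -> hs n l ->
  forall i, down_ptn q l n i = maxn (l i.+1) (q i.+1) + minn (l i) (q i) - n i.+1.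
Proof.
move=> /hsP hq /hsP hl; apply: mkptnE; split=> [i||].
- have := hq i.+2; have := hl i.+2.
  by have := hq i; have := hl i; have := hq i.+1; have := hl i.+1; lia.
- by have := hq 0; have := hl 0; have := hq 1; have := hl 1; have := prow_max l 0; lia.
by have := prow_out l (leqnn M); have := prow_out l (leqnSn M); have := prow_out q (leqnSn M); lia.
Qed.

(* The local growth rule of the Robinson-Schensted-Knuth correspondence. *)
Lemma Dop_Hop x k v q : psz q + x <= M ->
  Dop x (Hop k v) q = (\sum_(y < x.+1 | (y <= k)%N) Hop (k - y) (Dop (x - y) v) q)%R.
Proof.
move=> le_M; rewrite /Dop /Hop.
under [RHS]eq_bigr => y _ do rewrite (exchange_big_dep xpredT) //=.
rewrite (exchange_big_dep xpredT) //= [RHS]exchange_big /=; apply: eq_bigr => l _.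
(* On the right [m] determines [y] as [k + psz m - psz q]; all that remains of the sum over [y] is
   that this number is not negative. *)
transitivity (\sum_(m | [&& hs q m, hs l m, psz q + x == psz l + k & psz q <= psz m + k]%N) v l)%R;
    last first.
  under [RHS]eq_bigr => y _ do rewrite big_mkcond /=.
  rewrite exchange_big /= big_mkcond /=; apply: eq_bigr => m _.
  case: ifP => [/and4P[hq hl /eqP E le]|nc]; last first.
    rewrite big1 // => y le_yk; case: ifP => // /andP[/andP[hq /eqP E1] /andP[hl /eqP E2]].
    by move: nc; rewrite hq hl /= => /negbT/negP[]; apply/andP; split; [apply/eqP|]; have := ltn_ord y; lia.
  have le1 : psz m <= psz q by apply: psz_le => i; case/andP: (hsP _ _ hq i).
  have le2 : psz m <= psz l by apply: psz_le => i; case/andP: (hsP _ _ hl i).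
  have lt : k + psz m - psz q < x.+1 by lia.
  rewrite (bigD1 (Ordinal lt)) /=; last by lia.
  rewrite hq hl /= ifT; last by apply/andP; split; apply/eqP; lia.
  rewrite big1 ?addr0 // => y /andP[le_yk /eqP ne].
  case: ifP => // /andP[/eqP E1 /eqP E2].
  by case: ne; apply: val_inj => /=; lia.
apply: (@sum_bij _ _ _ _ _ (down_ptn q l)
          (fun m => up_ptn q l (k + psz m - psz q) m)) => [n|m|//].
  move=> /andP[/andP[hq /eqP E1] /andP[hl /eqP E2]].
  have dE := down_ptnE hq hl; move: (hq) (hl) => /hsP iq /hsP il.
  set m := down_ptn q l n in dE *.
  have hqm : hs q m.
    by apply/hsP => i; rewrite dE; have := iq i; have := il i; have := iq i.+1; have := il i.+1; lia.
  have hlm : hs l m.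
    by apply/hsP => i; rewrite dE; have := iq i; have := il i; have := iq i.+1; have := il i.+1; lia.
  have E : psz m + psz n + maxn (l 0) (q 0) = psz q + psz l + n 0.
    rewrite -(@sum_shift M n M.+1) // sum_recl -sum_maxmin.
    rewrite [X in _ = _ + X + _](_ : _ = psz m + \sum_(i < M) n i.+1); first by lia.
    rewrite -big_split; apply: eq_bigr => i _ /=; rewrite dE.
    by have := iq i; have := il i; lia.
  have n0 : maxn (l 0) (q 0) <= n 0 by have := iq 0; have := il 0; lia.
  split; first by rewrite hqm hlm /=; apply/andP; split; [apply/eqP|]; lia.
  have [|uE _] := @up_ptnE q l (k + psz m - psz q) m hqm hlm; first by lia.
  apply: ptnP => -[|i] _; rewrite uE /up_fun; first by lia.
  by rewrite dE; have := iq i; have := il i; have := iq i.+1; have := il i.+1; lia.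
move=> /and4P[hq hl /eqP E le].
have le1 : psz m <= psz q by apply: psz_le => i; case/andP: (hsP _ _ hq i).
have [|uE Eu] := @up_ptnE q l (k + psz m - psz q) m hq hl; first by lia.
move: (hq) (hl) => /hsP iq /hsP il.
set n := up_ptn _ _ _ _ in uE Eu *.
have hnq : hs n q.
  apply/hsP => i; rewrite !uE /up_fun; have := iq i; have := il i; case: (i) => [|j]; first lia.
  by have := iq j; have := il j; lia.
have hnl : hs n l.
  apply/hsP => i; rewrite !uE /up_fun; have := iq i; have := il i; case: (i) => [|j]; first lia.
  by have := iq j; have := il j; lia.
split; first by rewrite hnq hnl /=; apply/andP; split; apply/eqP; lia.
apply: ptnP => i _; rewrite down_ptnE // uE /up_fun.
by have := iq i; have := il i; lia.
Qed.

End LocalRule.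

Lemma perm_foldr_comm (S : eqType) (T : Type) (op : S -> T -> T) (z : T) (s t : seq S) :
  (forall x y w, op x (op y w) = op y (op x w)) -> perm_eq s t ->
  foldr op z s = foldr op z t.
Proof.
move=> opC; elim: s t => [|x s IHs] t; first by rewrite perm_sym => /perm_nilP->.
move=> st; have tx : x \in t by rewrite -(perm_mem st) mem_head.
have E r : x \in r -> foldr op z r = op x (foldr op z (rem x r)).
  elim: r => //= y r IHr; rewrite in_cons eq_sym; case: eqP => [-> //|_ /= xr].
  by rewrite IHr // opC.
rewrite (E t tx) /=; congr (op _ _); apply: IHs.
by rewrite -(perm_cons x); apply: perm_trans st _; exact: perm_to_rem.
Qed.

(** * Coefficient functions of polynomials *)

Lemma subvecsP (m t : seq nat) : t \in subvecs m ->
  [/\ size t = size m, size (vsub m t) = size m & sumn t + sumn (vsub m t) = sumn m].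
Proof.
elim: m t => [|x m IHm] t; first by rewrite inE => /eqP->.
case/allpairsP => -[y s] /= [y_x s_m ->]; have [E1 E2 E3] := IHm s s_m.
move: y_x; rewrite -[0 :: _]/(iota 0 x.+1) mem_iota => le_yx.
rewrite /vsub /= -/(vsub m s) E1 E2; split=> //; lia.
Qed.

Lemma polymul_cons f g x m :
  polymul f g (x :: m) =
  (\sum_(y < x.+1) polymul (fun t => f (nat_of_ord y :: t))
                           (fun t => g ((x - y)%N :: t)) m)%R.
Proof.
rewrite /polymul (_ : subvecs (x :: m) = [seq y :: t | y <- index_iota 0 x.+1, t <- subvecs m]) //.
by rewrite big_allpairs_dep big_mkord.
Qed.

Lemma eq_polymul f f' g g' m :
  (forall t, size t = size m -> sumn t <= sumn m -> f t = f' t) ->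
  (forall t, size t = size m -> sumn t <= sumn m -> g t = g' t) ->
  polymul f g m = polymul f' g' m.
Proof.
move=> Ef Eg; rewrite /polymul; apply: eq_big_seq => t /subvecsP[E1 E2 E3].
by rewrite Ef ?Eg //; lia.
Qed.

Lemma polymul_nil f g : polymul f g [::] = (f [::] * g [::])%R.
Proof. by rewrite /polymul big_seq1. Qed.

Lemma polymul1 f m : polymul poly1 f m = f m.
Proof.
elim: m f => [|x m IHm] f; first by rewrite polymul_nil mul1r.
rewrite polymul_cons big_ord_recl /= big1 ?addr0.
  by rewrite -[RHS](IHm (fun t => f (x :: t))) subn0; apply: eq_polymul.
by move=> i _; rewrite /polymul big1_seq // => t _; rewrite mul0r.
Qed.

Lemma polymul_suml (I : Type) (s : seq I) (Q : pred I) (f : I -> Defs.poly) g m :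
  polymul (fun t => \sum_(i <- s | Q i) f i t)%R g m
  = (\sum_(i <- s | Q i) polymul (f i) g m)%R.
Proof.
by rewrite /polymul; under eq_bigr => t _ do rewrite mulr_suml; rewrite exchange_big.
Qed.

Lemma polymul_sumr (I : Type) (s : seq I) (Q : pred I) f (g : I -> Defs.poly) m :
  polymul f (fun t => \sum_(i <- s | Q i) g i t)%R m
  = (\sum_(i <- s | Q i) polymul f (g i) m)%R.
Proof.
by rewrite /polymul; under eq_bigr => t _ do rewrite mulr_sumr; rewrite exchange_big.
Qed.

Lemma polymul_linl (c : int) f f' g m :
  polymul (fun t => c * f t + f' t)%R g m = (c * polymul f g m + polymul f' g m)%R.
Proof.
rewrite /polymul; under eq_bigr => t _ do rewrite mulrDl -mulrA.
by rewrite big_split /= mulr_sumr.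
Qed.

Lemma sum_triangle (R : nmodType) (G : nat -> nat -> R) n :
  (\sum_(y < n.+1) \sum_(z < y.+1) G z y
   = \sum_(z < n.+1) \sum_(w < (n - z).+1) G z (z + w)%N)%R.
Proof.
elim: n => [|n IHn].
  by rewrite !big_ord1.
rewrite big_ord_recr IHn /= [X in (_ + X)%R = _]big_ord_recr [RHS]big_ord_recr /=.
rewrite addrA -big_split /=; congr (_ + _)%R; last first.
  by rewrite subnn big_ord_recl big_ord0 addr0 addn0.
apply: eq_bigr => z _; rewrite subSn; last by rewrite -ltnS.
rewrite [RHS]big_ord_recr /=.
by congr (_ + G _ _)%R; have := ltn_ord z; lia.
Qed.

Lemma polymulA f g h m :
  polymul (polymul f g) h m = polymul f (polymul g h) m.
Proof.
elim: m f g h => [|x m IHm] f g h; first by rewrite !polymul_nil mulrA.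
rewrite [LHS]polymul_cons [RHS]polymul_cons.
pose G z y := polymul (polymul (fun t => f (z :: t)) (fun t => g ((y - z)%N :: t)))
                      (fun t => h ((x - y)%N :: t)) m.
transitivity (\sum_(y < x.+1) \sum_(z < y.+1) G z y)%R.
  apply: eq_bigr => y _; rewrite -polymul_suml; apply: eq_polymul => // t _ _.
  exact: polymul_cons.
rewrite sum_triangle; apply: eq_bigr => z _; rewrite /G.
under eq_bigr => w _ do rewrite IHm.
rewrite -polymul_sumr; apply: eq_polymul => // t _ _; rewrite polymul_cons.
by apply: eq_bigr => w _; rewrite addKn subnDA.
Qed.

(** * The Pieri rule for polynomials *)

Definition hpoly (k : nat) : Defs.poly := fun m => (sumn m == k)%:R%R.

Section Pieri.
Variable M : nat.
Local Notation P := (ptn M).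
Local Notation V := (ptn M -> int).
Implicit Types (l m n q : P) (u v : V).

(** The Kostka number as the coefficient of the Schur function of [l] in a product of complete
    functions. Its symmetry in [m] is the commutation of the [Hop k]; [kostka_kos] identifies it
    with the tableau count. *)
Definition kos (l : P) (m : seq nat) : int := foldr (@Hop M) (basis (ptn0 M)) m l.

Definition spoly (v : V) : Defs.poly := fun s => (\sum_l v l * kos l s)%R.

Lemma perm_kos l (s t : seq nat) : perm_eq s t -> kos l s = kos l t.
Proof.
by move=> st; rewrite /kos (perm_foldr_comm _ _ st) // => i j v; exact: Hop_comm.
Qed.

Lemma kos_cons l (k : nat) (s : seq nat) :
  kos l (k :: s) = (\sum_(m | hs l m && (psz l == psz m + k)%N) kos m s)%R.
Proof. by []. Qed.

Lemma kos_psz l (s : seq nat) : kos l s != 0%R -> psz l = sumn s.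
Proof.
elim: s l => [|k s IHs] l.
  by rewrite /kos /= /basis; case: (l =P ptn0 M) => [->|_]; rewrite ?psz0 ?eqxx.
apply: contraNeq => ne; rewrite kos_cons big1 // => m /andP[_ /eqP E].
by apply/eqP; apply: contraNT ne => /IHs Em; rewrite E Em /= addnC.
Qed.

Lemma kos_length l (s : seq nat) : kos l s != 0%R -> l (size s) = 0.
Proof.
elim: s l => [|k s IHs] l.
  by rewrite /kos /= /basis; case: (l =P ptn0 M) => [->|_]; rewrite ?ptn0E ?eqxx.
apply: contraNeq => ne; rewrite kos_cons big1 // => m /andP[/hsP h _].
apply/eqP; apply: contraNT ne => /IHs Em; rewrite -leqn0 /=.
by have := h (size s); rewrite Em; lia.
Qed.

(** The first variable accounts for the last strip of each chain, and removing that strip is the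
    adjoint operator. *)
Lemma spoly_cons v x s : spoly v (x :: s) = spoly (Dop x v) s.
Proof.
rewrite /spoly; under eq_bigr => l _ do rewrite kos_cons mulr_sumr.
rewrite (exchange_big_dep xpredT) //=; apply: eq_bigr => m _.
by rewrite /Dop mulr_suml.
Qed.

Lemma spoly_nil v : spoly v [::] = v (ptn0 M).
Proof.
rewrite /spoly (bigD1 (ptn0 M)) //= big1 ?addr0 => [|l ne].
  by rewrite /kos /= /basis eqxx mulr1.
by rewrite /kos /= /basis (negPf ne) mulr0.
Qed.

Lemma eq_spoly u v s : (forall l, psz l = sumn s -> u l = v l) -> spoly u s = spoly v s.
Proof.
move=> E; apply: eq_bigr => l _; have [->|/kos_psz/E-> //] := eqVneq (kos l s) 0%R.
by rewrite !mulr0.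
Qed.

Lemma Hop_ptn0 k v : Hop k v (ptn0 M) = ((k == 0)%:R * v (ptn0 M))%R.
Proof.
case: k => [|k]; first by rewrite Hop0 mul1r.
rewrite mul0r /Hop big_pred0 // => m; rewrite psz0; apply/negP => /andP[_ /eqP]; lia.
Qed.

Lemma spoly_basis l s : spoly (basis l) s = kos l s.
Proof.
rewrite /spoly (bigD1 l) //= big1 ?addr0 => [|m ne]; first by rewrite /basis eqxx mul1r.
by rewrite /basis (negPf ne) mul0r.
Qed.

Lemma kos_ptn0 s : kos (ptn0 M) s = poly1 s.
Proof.
elim: s => [|k s IHs]; first by rewrite /kos /= /basis eqxx.
by rewrite /kos /= Hop_ptn0 -/(kos _ s) IHs /poly1 /=; case: eqP => _; rewrite ?mul1r ?mul0r.
Qed.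

(** Induction on the variables. The complete function splits according to the exponent [y] it gives
    to the first variable, and [Dop_Hop] is the same splitting for operators; the degree bound is
    the size bound of that rule. *)
Lemma pieri k v s : sumn s <= M -> polymul (hpoly k) (spoly v) s = spoly (Hop k v) s.
Proof.
elim: s k v => [|x s IHs] k v /= leM.
  by rewrite polymul_nil !spoly_nil Hop_ptn0 /hpoly /= eq_sym.
rewrite polymul_cons spoly_cons.
rewrite (@eq_spoly _ (fun q => \sum_(y < x.+1 | (y <= k)%N) Hop (k - y) (Dop (x - y) v) q)%R);
  last by move=> l El; rewrite Dop_Hop // El addnC.
rewrite {2}/spoly; under [RHS]eq_bigr => l _ do rewrite mulr_suml.
rewrite [RHS]exchange_big /= [RHS]big_mkcond /=. apply: eq_bigr => y _.
case: leqP => [le_yk|lt_ky].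
  rewrite -[RHS](IHs (k - y) (Dop (x - y) v)); last by lia.
  apply: eq_polymul => t _ _; last by rewrite spoly_cons.
  rewrite /hpoly /=; congr (nat_of_bool _)%:R%R; apply/eqP/eqP; lia.
rewrite /polymul big1_seq // => t _; rewrite /hpoly /= (_ : _ == _ = false) ?mul0r //.
by apply/eqP; lia.
Qed.

End Pieri.
Arguments kos {M} l m : simpl never.

(** * Multiplication operators *)

Section Operators.
Variable M : nat.
Local Notation P := (ptn M).
Local Notation V := (ptn M -> int).
Local Notation e0 := (basis (ptn0 M)).
Implicit Types (l m n q : P) (u v : V) (T S : V -> V).

(** The multiplications by symmetric functions, as polynomials in the [Hop k]. With inductive
    generation each property need only be checked on [Hop] and on linear combinations. *)
Inductive alg : (V -> V) -> Prop :=
| alg_id : alg id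
| alg_H k T : alg T -> alg (fun v => Hop k (T v))
| alg_lin (c : int) T S : alg T -> alg S -> alg (fun v n => c * T v n + S v n)%R.

Lemma alg_linear T : alg T -> forall (c : int) u v,
  T (fun n => c * u n + v n)%R = (fun n => c * T u n + T v n)%R.
Proof.
elim=> {T} [//|k T _ IH c u v|a T S _ IHT _ IHS c u v]; first by rewrite IH Hop_lin.
by rewrite IHT IHS; apply: functional_extensionality => n; ring.
Qed.

Lemma alg_Hop T k v : alg T -> T (Hop k v) = Hop k (T v).
Proof.
move=> aT; elim: aT v => {T} [//|j T _ IH v|a T S _ IHT _ IHS v].
  by rewrite IH Hop_comm.
by rewrite IHT IHS Hop_lin.
Qed.

Lemma alg_comm T S v : alg T -> alg S -> T (S v) = S (T v).
Proof.
move=> aT aS; elim: aT v => {T} [//|k T _ IH v|a T T' _ IHT _ IHS v].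
  by rewrite IH alg_Hop.
by rewrite IHT IHS (alg_linear aS).
Qed.

Lemma alg_comp T S : alg T -> alg S -> alg (fun v => T (S v)).
Proof.
move=> aT aS; elim: aT => {T} [//|k T _ IH|a T T' _ IHT _ IHS].
  exact: (alg_H k IH).
exact: (alg_lin a IHT IHS).
Qed.

Lemma alg0 : alg (fun v n => 0%R).
Proof.
rewrite (_ : (fun _ => _) = (fun v n => (-1) * v n + v n)%R); last first.
  by do 2!apply: functional_extensionality => ?; ring.
exact: alg_lin alg_id alg_id.
Qed.

Lemma alg_sum (I : Type) (s : seq I) (Q : pred I) (c : I -> int) (T : I -> V -> V) :
  (forall i, Q i -> alg (T i)) -> alg (fun v n => \sum_(i <- s | Q i) c i * T i v n)%R.
Proof.
move=> aT; elim: s => [|i s IHs].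
  rewrite (_ : (fun _ => _) = (fun v n => 0)%R); first exact: alg0.
  by do 2!apply: functional_extensionality => ?; rewrite big_nil.
have [Qi|nQi] := boolP (Q i).
  rewrite (_ : (fun _ => _) =
    (fun v n => c i * T i v n + \sum_(i <- s | Q i) c i * T i v n)%R); last first.
    by do 2!apply: functional_extensionality => ?; rewrite big_cons Qi.
  by apply: alg_lin (aT i Qi) IHs.
rewrite (_ : (fun _ => _) = (fun v n => \sum_(i <- s | Q i) c i * T i v n)%R) //.
by do 2!apply: functional_extensionality => ?; rewrite big_cons (negPf nQi).
Qed.

Lemma basis_expand v n : v n = (\sum_l v l * basis l n)%R.
Proof.
rewrite (bigD1 n) //= big1 ?addr0 => [|l ne]; first by rewrite /basis eqxx mulr1.
by rewrite /basis eq_sym (negPf ne) mulr0.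
Qed.

Lemma alg_zero T : alg T -> T (fun=> 0%R) = (fun=> 0%R).
Proof.
move=> aT; have := alg_linear aT (-1) (fun=> 0%R) (fun=> 0%R).
rewrite (_ : (fun _ => (-1 * 0 + 0)%R) = (fun=> 0%R)) => [->|].
  by apply: functional_extensionality => n; ring.
by apply: functional_extensionality => n; ring.
Qed.

Lemma alg_big T (I : Type) (s : seq I) (c : I -> int) (f : I -> V) : alg T ->
  T (fun n => \sum_(i <- s) c i * f i n)%R = (fun n => \sum_(i <- s) c i * T (f i) n)%R.
Proof.
move=> aT; elim: s => [|i s IHs].
  rewrite (_ : (fun n => _) = (fun=> 0%R)) ?(alg_zero aT).
    by apply: functional_extensionality => n; rewrite big_nil.
  by apply: functional_extensionality => n; rewrite big_nil.
rewrite (_ : (fun n => _) = (fun n => c i * f i n + \sum_(i <- s) c i * f i n)%R).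
  by rewrite (alg_linear aT) IHs; apply: functional_extensionality => n; rewrite big_cons.
by apply: functional_extensionality => n; rewrite big_cons.
Qed.

Lemma alg_expand T v n : alg T -> T v n = (\sum_l v l * T (basis l) n)%R.
Proof.
move=> aT; have /functional_extensionality Ev : forall n, v n = (\sum_l v l * basis l n)%R.
  exact: basis_expand.
by rewrite {1}Ev (alg_big _ v (fun l => basis l) aT).
Qed.

Definition ptail (l : P) : P := mkptn M (fun i => l i.+1).

Lemma ptailE l i : ptail l i = l i.+1.
Proof.
apply: mkptnE; split=> [j||]; first exact: prowS; first exact: prow_max.
by apply: prow_out.
Qed.

Lemma psz_ptail l : l 0 + psz (ptail l) = psz l.
Proof.
rewrite -[RHS](@sum_shift M l M.+1) // sum_recl; congr (_ + _).
by apply: eq_bigr => i _; rewrite ptailE.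
Qed.

Lemma hs_ptail l : hs l (ptail l).
Proof. by apply/hsP => i; rewrite ptailE leqnn prowS. Qed.

Lemma hs_head l m (k : nat) : hs l m -> psz l = psz m + k -> k <= l 0.
Proof.
move=> /hsP h E; have : psz (ptail l) <= psz m.
  by apply: psz_le => i; rewrite ptailE; case/andP: (h i).
by have := psz_ptail l; lia.
Qed.

Lemma hs_head_eq l m : hs l m -> psz l = psz m + l 0 -> m = ptail l.
Proof.
move=> /hsP h E; apply/esym/sub_psz_eq; last by have := psz_ptail l; lia.
by move=> i; rewrite ptailE; case/andP: (h i).
Qed.

Lemma hs_tail_eq l n : hs n (ptail l) -> psz n = psz l -> l 0 <= n 0 ->
  n 0 <= l 0 -> n = l.
Proof.
move=> h E le1 le2.
have : psz n = psz (ptail l) + n 0 by have := psz_ptail l; lia.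
move/(hs_head_eq h) => Et; apply: ptnP => -[|i] _; first by lia.
by rewrite -!ptailE Et.
Qed.

Lemma alg_span v :
  (forall n, v n != 0%R -> exists T, alg T /\ T e0 = basis n) ->
  exists T, alg T /\ T e0 = v.
Proof.
move=> ex_T.
have /fin_all_exists[f fP] n : exists T, v n != 0%R -> alg T /\ T e0 = basis n.
  have [/ex_T[T TP]|_] := boolP (v n != 0%R); first by exists T.
  by exists id.
exists (fun u m => \sum_(n | v n != 0%R) v n * f n u m)%R; split.
  by apply: alg_sum => n /fP[].
apply: functional_extensionality => m; rewrite [RHS]basis_expand.
rewrite [RHS](bigID (fun n => v n != 0%R)) /= [X in (_ + X)%R]big1 ?addr0.
  by apply: eq_bigr => n /fP[_ ->].
by move=> n /negPn/eqP ->; rewrite mul0r.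
Qed.

(* The Schur functions are polynomials in the complete symmetric functions:
   [Hop (l 0)] applied to [l] without its first row is [l] plus partitions with a
   longer first row. *)
Lemma alg_basis_step l :
  (exists T, alg T /\ T e0 = basis (ptail l)) ->
  (forall n, psz n = psz l -> l 0 < n 0 -> exists T, alg T /\ T e0 = basis n) ->
  exists T, alg T /\ T e0 = basis l.
Proof.
case=> T [aT ET] ex_big.
have HE n : Hop (l 0) (basis (ptail l)) n = (hs n (ptail l) && (psz n == psz l))%:R%R.
  rewrite /Hop -(psz_ptail l) [l 0 + _]addnC; case: (boolP (_ && _)) => h.
    rewrite (bigD1 (ptail l)) //= {1}/basis eqxx big1 ?addr0 // => m /andP[_ ne].
    by rewrite /basis (negPf ne).
  rewrite big1 // => m /andP[h1 E]; rewrite /basis; case: eqP => // Em.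
  by move: h; rewrite -Em h1 E.
have [|S [aS ES]] := @alg_span (fun n => Hop (l 0) (T e0) n - basis l n)%R.
  move=> n; rewrite ET HE /basis; case: (n =P l) => [->|ne].
    by rewrite hs_ptail (eqxx (psz l)) subrr eqxx.
  rewrite subr0; case: (boolP (_ && _)) => // /andP[h /eqP E] _; apply: ex_big => //.
  have le1 : l 0 <= n 0.
    by apply: (hs_head h); have := psz_ptail l; lia.
  by rewrite ltnNge; apply/negP => le2; apply: ne; apply: hs_tail_eq h E le1 le2.
exists (fun v n => (-1) * S v n + Hop (l 0) (T v) n)%R; split.
  by apply: alg_lin => //; apply: alg_H.
by rewrite ES; apply: functional_extensionality => n; ring.
Qed.

(** Two nested inductions serve the two premises of [alg_basis_step]: the tail has smaller size,
    bounded by [N], and the partitions with a longer first row have the same size but fewer boxes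
    below that row, a number bounded by [D]. *)
Lemma alg_basis_ind N D l : psz l <= N -> psz l <= l 0 + D ->
  exists T, alg T /\ T e0 = basis l.
Proof.
have z n : n 0 = 0 -> exists T, alg T /\ T e0 = basis n.
  move=> n0; exists id; split; first exact: alg_id.
  rewrite (_ : n = ptn0 M) //; apply: ptnP => i _; rewrite ptn0E.
  by have := prow_dec n (leq0n i); lia.
elim: N D l => [|N IHN] D l leN; first by move=> _; apply: z; have := prow0_leq_psz l; lia.
elim: D l leN => [|D IHD] l leN leD; have [/z //|l0] := posnP (l 0);
    apply: alg_basis_step => [|n En ltn].
- by apply: (IHN (psz (ptail l))); have := psz_ptail l; lia.
- by have := prow0_leq_psz n; lia.
- by apply: (IHN (psz (ptail l))); have := psz_ptail l; lia.
- by apply: IHD; lia.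
Qed.

Lemma alg_basis l : exists T, alg T /\ T e0 = basis l.
Proof. exact: alg_basis_ind (leqnn _) (leq_addl _ _). Qed.

(** Multiplication by the Schur function of [l]. The choice is harmless: by [alg_eq] only one
    operator of the algebra sends [e0] to [basis l]. *)
Definition Mop l : V -> V :=
  sval (constructive_indefinite_description _ (alg_basis l)).

Lemma alg_Mop l : alg (Mop l).
Proof. by rewrite /Mop; case: constructive_indefinite_description => T []. Qed.

Lemma Mop_e0 l : Mop l e0 = basis l.
Proof. by rewrite /Mop; case: constructive_indefinite_description => T []. Qed.

(** Every basis vector is [Mop l e0], and operators of the algebra commute, so the value at [e0]
    propagates to all vectors. *)
Lemma alg_eq T S : alg T -> alg S -> T e0 = S e0 -> T = S.
Proof.
move=> aT aS E; apply: functional_extensionality => v.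
apply: functional_extensionality => n; rewrite (alg_expand v n aT) (alg_expand v n aS).
apply: eq_bigr => l _; rewrite -Mop_e0 (alg_comm _ aT (alg_Mop l)) E.
by rewrite -(alg_comm _ aS (alg_Mop l)).
Qed.

Lemma Mop0 : Mop (ptn0 M) = id.
Proof. by apply: (alg_eq (alg_Mop _) alg_id); rewrite Mop_e0. Qed.

(** The relation [newton_HE] expresses [Eop k] through the [Hop] and the earlier [Eop i]. Membership
    in the algebra makes vertical strips commute with every multiplication. *)
Lemma alg_Eop k : alg (@Eop M k).
Proof.
elim/ltn_ind: k => -[_|k IHk].
  rewrite (_ : @Eop M 0 = id); first exact: alg_id.
  by apply: functional_extensionality => v; rewrite Eop0.
rewrite (_ : @Eop M k.+1 =
  (fun v n => \sum_(i < k.+1) (- (-1) ^+ (k.+1 + i)) * Hop (k.+1 - i) (Eop i v) n)%R).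
  apply: alg_sum => i _; apply: alg_H; exact: IHk.
apply: functional_extensionality => v; apply: functional_extensionality => n.
have /(congr1 (fun f => f n)) := newton_HE k.+1 v.
rewrite mul0r big_ord_recr /= subnn Hop0 => /eqP; rewrite addrC addr_eq0 => /eqP E.
rewrite -[LHS]mul1r -[X in (X * _)%R = _](sqrr_sign _ k.+1) expr2 -mulrA E mulrN mulr_sumr -sumrN.
by apply: eq_bigr => i _; rewrite exprD mulrA mulNr.
Qed.

(** The Pieri rule is the generator case; associativity and linearity carry it to the whole algebra.
    This turns the products of operators in [lrc] into products of polynomials. *)
Lemma polymul_alg T v (s : seq nat) : alg T -> sumn s <= M ->
  polymul (spoly (T e0)) (spoly v) s = spoly (T v) s.
Proof.
move=> aT; elim: aT s => {T} [|k T _ IH|c T S _ IHT _ IHS] s leM.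
- rewrite -[RHS]polymul1; apply: eq_polymul => // t _ _.
  by rewrite spoly_basis kos_ptn0.
- rewrite -pieri // (eq_polymul (f' := polymul (hpoly k) (spoly (T e0))) (g' := spoly v)) //.
    by rewrite polymulA; apply: eq_polymul => // t _ le; apply: IH; apply: leq_trans leM.
  by move=> t _ le; rewrite pieri //; apply: leq_trans leM.
have lin u u' t : spoly (fun n => c * u n + u' n)%R t = (c * spoly u t + spoly u' t)%R.
  rewrite /spoly mulr_sumr -big_split; apply: eq_bigr => l _ /=; ring.
rewrite lin -IHT // -IHS // -polymul_linl; apply: eq_polymul => // t _ _; exact: lin.
Qed.

Definition lrc (ls : seq P) : V := foldr Mop e0 ls.

Lemma Mop_comm l m v : Mop l (Mop m v) = Mop m (Mop l v).
Proof. exact: alg_comm (alg_Mop _) (alg_Mop _). Qed.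

Lemma perm_lrc (ls ms : seq P) : perm_eq ls ms -> lrc ls = lrc ms.
Proof. by move=> lm; apply: perm_foldr_comm => // l m v; exact: Mop_comm. Qed.

Lemma polyprod_lrc (ls : seq P) (s : seq nat) : sumn s <= M ->
  polyprod [seq kos l | l <- ls] s = spoly (lrc ls) s.
Proof.
elim: ls s => [|l ls IH] s leM; first by rewrite /= spoly_basis kos_ptn0.
rewrite /= -polymul_alg ?alg_Mop //; last exact: alg_Mop.
apply: eq_polymul => t _ le; last by apply: IH; apply: leq_trans leM.
by rewrite Mop_e0 spoly_basis.
Qed.

Lemma lrc_cat0 (ls : seq P) (I : Type) (s : seq I) :
  lrc (ls ++ [seq ptn0 M | _ <- s]) = lrc ls.
Proof.
rewrite /lrc foldr_cat; congr foldr.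
by elim: s => //= _ s ->; rewrite Mop0.
Qed.

Lemma alg_lrc (ls : seq P) : exists T, alg T /\ forall v, foldr Mop v ls = T v.
Proof.
elim: ls => [|l ls [T [aT ET]]]; first by exists id; split; [exact: alg_id|].
exists (fun v => Mop l (T v)); split=> [|v /=]; last by rewrite ET.
exact: alg_comp (alg_Mop l) aT.
Qed.

End Operators.

(** * Conjugation *)

Section Conjugation.
Variable M : nat.
Local Notation P := (ptn M).
Local Notation V := (ptn M -> int).
Local Notation e0 := (basis (ptn0 M)).
Implicit Types (l m n q : P) (u v : V) (T S : V -> V).

Definition conj_fun l (j : nat) : nat := find (fun i => l i <= j) (iota 0 M).
Definition conj l : P := mkptn M (conj_fun l).

Lemma conj_funP l i j : (i < conj_fun l j) = (j < l i).
Proof.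
have le_M : conj_fun l j <= M by rewrite -[X in _ <= X](size_iota 0) find_size.
apply/idP/idP => [lt_i|lt_j].
  have lt_iM := leq_trans lt_i le_M.
  by have := before_find 0 lt_i; rewrite nth_iota // add0n ltnNge => ->.
have lt_iM : i < M by rewrite ltnNge; apply/negP => /(prow_out l) E; rewrite E in lt_j.
rewrite ltnNge; apply/negP => le_i.
have lt_cM : conj_fun l j < M := leq_ltn_trans le_i lt_iM.
have : has (fun i => l i <= j) (iota 0 M) by rewrite has_find size_iota.
move/(nth_find 0); rewrite nth_iota // add0n => le_j.
by have := prow_dec l le_i; have := le_j; rewrite -/(conj_fun l j); lia.
Qed.

Lemma ltn_ext (x y : nat) : (forall i, (i < x) = (i < y)) -> x = y.
Proof. by move=> E; have := E x; have := E y; rewrite !ltnn; lia. Qed.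

(** Stated as a relation symmetric in rows and columns, so that [ltn_ext] turns identities between
    conjugates into comparisons of single boxes. *)
Lemma conjP l i j : (i < conj l j) = (j < l i).
Proof.
rewrite /conj mkptnE ?conj_funP //; split=> [k||].
- rewrite leqNgt conj_funP -leqNgt.
  by rewrite leqNgt; apply/negP => lt; have := conj_funP l (conj_fun l k) k; lia.
- by rewrite leqNgt conj_funP (prow_out l (leqnn M)).
- apply/eqP; rewrite -leqn0 leqNgt conj_funP -leqNgt; exact: prow_max.
Qed.

Lemma conjK : involutive conj.
Proof. by move=> l; apply: ptnP => i _; apply: ltn_ext => j; rewrite !conjP. Qed.

Lemma sum_ltn x r : \sum_(i < r) (i < x) = minn x r.
Proof.
elim: r => [|r IHr]; first by rewrite big_ord0 minn0.
by rewrite big_ord_recr /= IHr; lia.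
Qed.

(** The boxes in the first [t] columns, counted by columns and by rows. *)
Lemma sum_conj l t : \sum_(i < t) conj l i = \sum_(j < M) minn (l j) t.
Proof.
transitivity (\sum_(i < t) \sum_(j < M) (j < conj l i)).
  by apply: eq_bigr => i _; rewrite sum_ltn (minn_idPl (prow_max _ _)).
rewrite exchange_big /=; apply: eq_bigr => j _.
by rewrite -sum_ltn; apply: eq_bigr => i _; rewrite conjP.
Qed.

Lemma psz_conj l : psz (conj l) = psz l.
Proof.
rewrite /psz sum_conj; apply: eq_bigr => j _; exact/minn_idPl/prow_max.
Qed.

Lemma conj0 : conj (ptn0 M) = ptn0 M.
Proof. by apply: psz_eq0; rewrite psz_conj psz0. Qed.

Lemma hs_conj n m : hs (conj n) (conj m) = vs n m.
Proof.
apply/hsP/vsP => h i.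
  apply/andP; split; rewrite leqNgt; apply/negP => lt.
    have := h (n i); have := conjP m i (n i); have := conjP n i (n i); lia.
  have := h (m i); have := conjP m i (m i); have := conjP n i (m i).+1; lia.
apply/andP; split; rewrite leqNgt; apply/negP => lt.
  have := conjP n (conj m i) i.+1; have := conjP m (conj m i) i.
  by have := h (conj m i); lia.
have := conjP m (conj n i) i; have := conjP n (conj n i) i.
by have := h (conj n i); lia.
Qed.

Definition conjv v : V := fun n => v (conj n).

Lemma conjvK v : conjv (conjv v) = v.
Proof. by apply: functional_extensionality => n; rewrite /conjv conjK. Qed.

Lemma conjv_basis l : conjv (basis l) = basis (conj l).
Proof.
apply: functional_extensionality => n; rewrite /conjv /basis.
by rewrite -(inj_eq (can_inj conjK)) conjK.
Qed.

Lemma conjv_Hop k v : conjv (Hop k v) = Eop k (conjv v).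
Proof.
apply: functional_extensionality => n; rewrite /conjv /Hop /Eop.
apply: (@sum_bij _ _ _ _ _ conj conj) => m.
- by rewrite -hs_conj !psz_conj !conjK => ->.
- by rewrite -hs_conj !psz_conj !conjK => ->.
- by rewrite conjK.
Qed.

(** Conjugation turns [Hop] into [Eop], which [alg_Eop] puts back in the algebra: this is the
    involution exchanging complete and elementary functions. *)
Lemma alg_conj T : alg T -> alg (fun v => conjv (T (conjv v))).
Proof.
elim=> {T} [|k T _ IH|c T S _ IHT _ IHS].
- rewrite (_ : (fun _ => _) = id); first exact: alg_id.
  by apply: functional_extensionality => v; rewrite conjvK.
- rewrite (_ : (fun _ => _) = (fun v => Eop k (conjv (T (conjv v))))).
    exact: (alg_comp (alg_Eop M k) IH).
  by apply: functional_extensionality => v; rewrite conjv_Hop.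
exact: (alg_lin c IHT IHS).
Qed.

Lemma Mop_conj l v : Mop (conj l) v = conjv (Mop l (conjv v)).
Proof.
have := @alg_eq M _ _ (alg_Mop (conj l)) (alg_conj (alg_Mop l)).
move/(_ _)/(congr1 (fun f => f v)) => -> //.
by rewrite Mop_e0 conjv_basis conj0 Mop_e0 conjv_basis.
Qed.

Lemma lrc_conj (ls : seq P) n : lrc (map conj ls) (conj n) = lrc ls n.
Proof.
have -> : lrc (map conj ls) = conjv (lrc ls).
  elim: ls => [|l ls IH]; first by rewrite /lrc /= conjv_basis conj0.
  by rewrite /lrc /= -!/(lrc _) Mop_conj IH conjvK.
by rewrite /conjv conjK.
Qed.

Lemma lrc_conj_map (I : Type) (s : seq I) (f : I -> P) n :
  lrc [seq conj (f i) | i <- s] (conj n) = lrc [seq f i | i <- s] n.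
Proof. by rewrite (map_comp conj f) lrc_conj. Qed.

(** * Duality in a box *)

Definition inbox (A B : nat) l : bool := (l 0 <= B) && (l A == 0).
Definition boxp (A B : nat) : P := mkptn M (fun i => if i < A then B else 0).
Definition compl (A B : nat) l : P :=
  mkptn M (fun i => if i < A then B - l (A - i.+1) else 0).

Section Box.
Variables A B : nat.
Lemma inboxP l : reflect (forall i, l i <= if i < A then B else 0) (inbox A B l).
Proof.
apply: (iffP andP) => [[le /eqP E] i|h].
  case: ltnP => [_|leAi]; first exact: leq_trans (prow_dec l (leq0n i)) le.
  by rewrite -E; apply: prow_dec.
split; last by rewrite -leqn0; have := h A; rewrite ltnn.
by have := h 0; case: (ltnP 0 A) => //; lia.
Qed.

Lemma hs_inbox n m : hs n m -> inbox A B n -> inbox A B m.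
Proof.
move=> /hsP h /inboxP b; apply/inboxP => i.
by apply: leq_trans (b i); case/andP: (h i).
Qed.

Hypotheses (leA : A <= M) (leB : B <= M).

Lemma boxpE i : boxp A B i = if i < A then B else 0.
Proof.
apply: mkptnE; split=> [j||]; first by case: ifP; case: ifP; lia.
  by case: ifP.
by rewrite ltnNge leA.
Qed.

Lemma complE l i : compl A B l i = if i < A then B - l (A - i.+1) else 0.
Proof.
apply: mkptnE; split=> [j||].
- case: ifP => // lt; rewrite ifT ?leq_sub2l //; last by lia.
  by apply: prow_dec; lia.
- by case: ifP => // _; lia.
by rewrite ltnNge leA.
Qed.

Lemma inbox_compl l : inbox A B (compl A B l).
Proof. by apply/inboxP => i; rewrite complE; case: ifP => // _; lia. Qed.

Lemma complK l : inbox A B l -> compl A B (compl A B l) = l.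
Proof.
move=> /inboxP h; apply: ptnP => i _; rewrite complE; have := h i; case: ltnP => lt; last by lia.
rewrite complE ifT; last by lia.
by rewrite (_ : A - _.+1 = i); lia.
Qed.

Lemma psz_compl l : inbox A B l -> psz (compl A B l) + psz l = A * B.
Proof.
move=> /inboxP h.
have E m : (forall i, A <= i -> m i = 0) -> psz m = \sum_(i < A) m i.
  by move=> m0; apply/eqP; rewrite eqn_leq; apply/andP; split; [exact: sum_ord_vanish|exact: sum_ord_leq].
have h0 i : A <= i -> l i = 0 by move=> leAi; have := h i; rewrite ltnNge leAi /=; lia.
have c0 i : A <= i -> compl A B l i = 0 by move=> leAi; rewrite complE ltnNge leAi.
rewrite (E _ h0) (E _ c0) [X in _ + X](reindex_inj rev_ord_inj) -big_split /=.
rewrite (eq_bigr (fun=> B)) ?sum_nat_const ?card_ord // => i _.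
rewrite complE ltn_ord subnK //; have := h (A - i.+1); have := ltn_ord i.
by case: ifP => //; lia.
Qed.

Lemma hs_compl n m : hs n m -> inbox A B n -> hs (compl A B m) (compl A B n).
Proof.
move=> /hsP h /inboxP b; apply/hsP => i; rewrite !complE.
case: (ltnP i A) => lt; last by rewrite ifN // -leqNgt ltnW.
case: (ltnP i.+1 A) => lt'; last by have := h (A - i.+1); lia.
have := h (A - i.+2); have := h (A - i.+1).
by rewrite (_ : (A - i.+2).+1 = A - i.+1); lia.
Qed.

Lemma compl0 : compl A B (ptn0 M) = boxp A B.
Proof. by apply: ptnP => i _; rewrite complE boxpE ptn0E subn0. Qed.

Lemma inbox0 : inbox A B (ptn0 M).
Proof. by apply/inboxP => i; rewrite ptn0E. Qed.

Lemma psz_boxp : psz (boxp A B) = A * B.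
Proof. by rewrite -compl0 -(psz_compl inbox0) psz0 addn0. Qed.

(** A pairing that is paired with [e0] the coefficient of the full rectangle, see [bpair_e0], and
    for which all multiplications are self-adjoint, see [bpair_alg]. *)
Definition bpair u v : int := (\sum_(l | inbox A B l) u l * v (compl A B l))%R.

(** Complementation reverses a horizontal strip and preserves its size, so it matches the terms of
    the two sides. *)
Lemma bpair_Hop k u v : bpair (Hop k u) v = bpair u (Hop k v).
Proof.
rewrite /bpair /Hop; under eq_bigr => l _ do rewrite mulr_suml.
rewrite (exchange_big_dep (inbox A B)) /= => [|n m bn /andP[h _]]; last exact: hs_inbox h bn.
apply: eq_bigr => m bm; rewrite mulr_sumr.
apply: (@sum_bij _ _ _ _ _ (compl A B) (compl A B)) => [n|n|//].
  move=> /andP[bn /andP[h /eqP E]]; rewrite hs_compl // complK //; split=> //.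
  by have := psz_compl bn; have := psz_compl bm; lia.
move=> /andP[h /eqP E].
have bn : inbox A B n by apply: hs_inbox h _; exact: inbox_compl.
rewrite inbox_compl complK //; split=> //=; rewrite -[X in hs _ X](complK bm) hs_compl ?inbox_compl //=.
by have := psz_compl bn; have := psz_compl bm; lia.
Qed.

Lemma bpair_alg T u v : alg T -> bpair (T u) v = bpair u (T v).
Proof.
move=> aT; elim: aT u v => {T} [//|k T aT IH u v|c T S _ IHT _ IHS u v].
  by rewrite bpair_Hop IH alg_Hop.
transitivity (c * bpair (T u) v + bpair (S u) v)%R.
  by rewrite /bpair mulr_sumr -big_split; apply: eq_bigr => l _ /=; ring.
rewrite IHT IHS /bpair mulr_sumr -big_split; apply: eq_bigr => l _ /=; ring.
Qed.

Lemma bpair_e0 v : bpair e0 v = v (boxp A B).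
Proof.
rewrite /bpair (bigD1 (ptn0 M)) /=; last exact: inbox0.
rewrite big1 => [|l /andP[_ ne]]; last by rewrite /basis (negPf ne) mul0r.
by rewrite /basis eqxx mul1r addr0 compl0.
Qed.

(** Read the coefficient of the rectangle as a pairing with [e0], then move the multiplication by
    the first product to the other side. *)
Lemma lrc_box (ls ms : seq P) :
  lrc (ls ++ ms) (boxp A B) = (\sum_(l | inbox A B l) lrc ls l * lrc ms (compl A B l))%R.
Proof.
have [T [aT ET]] := alg_lrc ls.
by rewrite /lrc foldr_cat -/(lrc ms) !ET -bpair_e0 -(bpair_alg _ _ aT).
Qed.

End Box.
End Conjugation.

(** * Linear independence and leading terms *)

Section Leading.
Variable M : nat.
Local Notation P := (ptn M).
Local Notation V := (ptn M -> int).
Local Notation e0 := (basis (ptn0 M)).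
Implicit Types (l m n q : P) (u v : V) (s t : seq nat).

Lemma kos_small_head l (k : nat) s : l 0 < k -> kos l (k :: s) = 0%R.
Proof.
move=> lt; rewrite kos_cons big_pred0 // => m; apply/negP => /andP[h /eqP E].
by have := hs_head h E; lia.
Qed.

Lemma kos_head l s : kos l (l 0 :: s) = kos (ptail l) s.
Proof.
rewrite kos_cons (big_pred1 (ptail l)) // => m; apply/andP/eqP => [[h /eqP E]|->].
  exact: hs_head_eq.
by rewrite hs_ptail addnC psz_ptail.
Qed.

(* Peel off the largest first row occurring in [u]. *)
Lemma kos_free r X u :
  (forall s, size s = r -> sumn s <= X -> spoly u s = 0%R) ->
  forall l, psz l <= X -> l r = 0 -> u l = 0%R.
Proof.
elim: r X u => [|r IHr] X u u0 l leX l0.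
  rewrite (_ : l = ptn0 M); first by rewrite -spoly_nil u0.
  by apply: ptnP => i _; rewrite ptn0E; have := prow_dec l (leq0n i); lia.
(* Descending induction on the first row, which cannot exceed [X]; [N] bounds its distance from
   [X.+1]. *)
have gen N : forall l, psz l <= X -> l r.+1 = 0 -> X < l 0 + N -> u l = 0%R.
  elim: N => [|N IHN] {l leX l0} l leX l0 ltN; first by have := prow0_leq_psz l; lia.
  set k := l 0.
  pose Q n := [&& n 0 == k, psz n <= X & n r.+1 == 0].
  pose w q := (\sum_(n | Q n && (ptail n == q)) u n)%R.
  (* At exponent [k] of the first variable, shorter first rows contribute nothing and longer ones
     have coefficient zero by induction. What is left is the polynomial of [w] in the remaining [r]
     variables. *)
  have w0 : w (ptail l) = 0%R.
    apply: (IHr (X - k)) => [s Es les||]; last by rewrite ptailE.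
      rewrite -[RHS](u0 (k :: s)) /=; [|by rewrite Es|]; last first.
        by have := prow0_leq_psz l; rewrite -/k; lia.
      rewrite /spoly; under eq_bigr => q _ do rewrite mulr_suml.
      rewrite (exchange_big_dep Q) /= => [|q n _ /andP[] //].
      rewrite big_mkcond /=; apply: eq_bigr => n _.
      have [/and3P[/eqP Ek leXn n0]|nQ] := boolP (Q n).
        rewrite (big_pred1 (ptail n)) => [|q]; last by rewrite eq_sym.
        by rewrite -Ek kos_head.
      have [->|ne] := eqVneq (kos n (k :: s)) 0%R; first by rewrite mulr0.
      have Esz := kos_psz ne; have := kos_length ne; rewrite /= Es => n0.
      have leXn : psz n <= X.
        by move: Esz => /=; have := prow0_leq_psz l; rewrite -/k; lia.
      have [lt|le] := ltnP (n 0) k; first by rewrite kos_small_head // eqxx in ne.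
      rewrite IHN ?mul0r //; move: nQ; rewrite /Q leXn n0 eqxx !andbT; lia.
    by have := psz_ptail l; rewrite -/k; lia.
  rewrite -w0 /w (big_pred1 l) // => n; apply/andP/eqP => [[/and3P[/eqP Ek _ _] /eqP Et]|->].
    by apply: ptnP => -[|i] _; rewrite ?Ek // -!ptailE Et.
  by rewrite /Q !eqxx leX l0.
by apply: (gen X.+1) => //; lia.
Qed.

Definition topsz (d : nat) l : nat := \sum_(i < d) l i.
Definition ptop (d : nat) l : P := mkptn M (fun i => if i < d then l i else 0).
Definition prest (d : nat) l : P := mkptn M (fun i => l (d + i)).

Lemma ptopE d l i : ptop d l i = if i < d then l i else 0.
Proof.
apply: mkptnE; split=> [j||]; first by have := prowS l j; case: ifP; case: ifP; lia.
  by case: ifP => // _; exact: prow_max.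
by rewrite prow_out ?if_same.
Qed.

Lemma prestE d l i : prest d l i = l (d + i).
Proof.
apply: mkptnE; split=> [j||]; first by rewrite addnS prowS.
  exact: prow_max.
by rewrite prow_out ?leq_addl.
Qed.

Lemma psz_short d l : l d = 0 -> psz l = topsz d l.
Proof.
move=> ld; have l0 i : d <= i -> l i = 0 by move/(prow_dec l); lia.
apply/eqP; rewrite eqn_leq; apply/andP; split; first exact: sum_ord_vanish.
by apply: sum_ord_vanish => i; exact: prow_out.
Qed.

Lemma psz_ptop d l : psz (ptop d l) = topsz d l.
Proof.
rewrite (@psz_short d) ?ptopE ?ltnn //; apply: eq_bigr => i _.
by rewrite ptopE ltn_ord.
Qed.

Lemma psz_prest d l : topsz d l + psz (prest d l) = psz l.
Proof.
rewrite -[RHS](@sum_shift M l (d + M)) ?leq_addl // big_split_ord /=; congr (_ + _).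
by apply: eq_bigr => i _; rewrite prestE.
Qed.

(** A chain of strips starts with the [d] strips of [mx]; their shape has at most [d] rows and lies
    in [l], hence in [ptop d l]. In extremal degree it equals [ptop d l], and the strips of [my]
    build up [prest d l] below it. *)
Lemma kos_top d l (my mx : seq nat) : size mx = d ->
  (topsz d l < sumn mx -> kos l (my ++ mx) = 0%R) /\
  (sumn mx = topsz d l ->
     kos l (my ++ mx) = (kos (ptop d l) mx * kos (prest d l) my)%R).
Proof.
move=> Ed; elim: my l => [|k my IH] l /=.
  split=> [lt|E].
    have [//|ne] := eqVneq (kos l mx) 0%R.
    by have := kos_psz ne; have := kos_length ne; rewrite Ed => /psz_short; lia.
  have := psz_prest d l; have [Er|ne] := eqVneq (prest d l) (ptn0 M).
    rewrite Er psz0 addn0 => El; rewrite /kos [X in (_ * X)%R]/= /basis eqxx mulr1.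
    congr (foldr _ _ _ _); apply/esym/sub_psz_eq; last by rewrite psz_ptop.
    by move=> i; rewrite ptopE; case: ifP.
  move=> Esz; rewrite /(kos (prest _ _)) /= /basis (negPf ne) mulr0.
  have [//|/kos_psz El] := eqVneq (kos l mx) 0%R.
  by case/eqP: ne; apply: psz_eq0; lia.
have le_top m : hs l m -> topsz d m <= topsz d l.
  by move=> /hsP h; apply: leq_sum => i _; case/andP: (h i).
split=> [lt|E].
  rewrite kos_cons big1 // => m /andP[/le_top le _].
  by have [-> //] := IH m; lia.
rewrite !kos_cons mulr_sumr (bigID (fun m => topsz d m == topsz d l)) /=.
rewrite [X in (_ + X)%R]big1 ?addr0; last first.
  move=> m /andP[/andP[/le_top le _] ne]; have [-> //] := IH m; lia.
have eq_top m : hs l m -> topsz d m = topsz d l -> forall i, i < d -> m i = l i.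
  move=> /hsP h Et i lti; apply/eqP; rewrite eqn_leq; have /andP[_ -> /=] := h i.
  rewrite leqNgt; apply/negP => ltm; suff : topsz d m < topsz d l by lia.
  rewrite /topsz (bigD1 (Ordinal lti)) //= [X in _ < X](bigD1 (Ordinal lti)) //=.
  by rewrite -addSn leq_add // leq_sum // => j _; case/andP: (h j).
(* The inverse of [prest d] on the partitions [m] that share the first [d] rows of [l]. *)
pose glue (r : P) : P := mkptn M (fun i => if i < d then l i else r (i - d)).
have glueE r : hs (prest d l) r -> forall i, glue r i = if i < d then l i else r (i - d).
  move=> /hsP h; apply: mkptnE; split=> [i||].
  - case: (ltnP i d) => lt1; case: (ltnP i.+1 d) => lt2; [exact: prowS| |by lia|].
      have := h 0; rewrite !prestE (_ : i.+1 - d = 0) ?addn0; last by lia.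
      by have := prow_dec l (ltnW lt1); lia.
    by rewrite subSn // prowS.
  - by case: ifP => _; exact: prow_max.
  case: ltnP => // [_|le]; first exact: prow_out.
  by have := h (M - d); rewrite !prestE subnKC // (prow_out l (leqnn M)); lia.
apply: (@sum_bij _ _ _ _ _ (prest d) glue) => [m|r|m].
- move=> /andP[/andP[h /eqP Ek] /eqP Et]; have eqt := eq_top m h Et.
  have hr : hs (prest d l) (prest d m).
    by apply/hsP => i; rewrite !prestE addnS; move/hsP: h; exact.
  split; last first.
    apply: ptnP => i _; rewrite glueE //; case: ltnP => lt; first by rewrite eqt.
    by rewrite prestE subnKC.
  by rewrite hr /=; have := psz_prest d l; have := psz_prest d m; lia.
- move=> /andP[hr /eqP Ek]; have gE := glueE r hr.
  have Er : prest d (glue r) = r.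
    by apply: ptnP => i _; rewrite prestE gE ltnNge leq_addr /= addKn.
  have Et : topsz d (glue r) = topsz d l.
    by apply: eq_bigr => i _; rewrite gE ltn_ord.
  split=> //; rewrite Et eqxx andbT; apply/andP; split.
    apply/hsP => i; rewrite gE; case: ltnP => lt; first by rewrite prowS leqnn.
    by move/hsP: hr => /(_ (i - d)); rewrite !prestE addnS subnKC.
  by have := psz_prest d l; have := psz_prest d (glue r); rewrite Er Et; lia.
- move=> /andP[/andP[h _] /eqP Et]; have [_ ->] := IH m; last by lia.
  congr (kos _ _ * _)%R; apply: ptnP => i _; rewrite !ptopE; case: ifP => // lti.
  exact: eq_top.
Qed.

(** * Leading parts of products in two groups of variables *)

Lemma sum_subvecs_cat (G : seq nat -> seq nat -> int) (my mx : seq nat) :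
  (\sum_(z <- subvecs (my ++ mx)) G z (vsub (my ++ mx) z)
   = \sum_(t <- subvecs my) \sum_(s <- subvecs mx) G (t ++ s) (vsub my t ++ vsub mx s))%R.
Proof.
elim: my G => [|x my IH] G; first by rewrite big_seq1.
have subE z : subvecs (x :: z) = [seq y :: t | y <- index_iota 0 x.+1, t <- subvecs z] by [].
rewrite cat_cons !subE !big_allpairs_dep; apply: eq_bigr => y _.
exact: (IH (fun z z' => G (y :: z) ((x - y)%N :: z'))).
Qed.

Lemma polymul_cat (f g : Defs.poly) (my mx : seq nat) :
  polymul f g (my ++ mx) = (\sum_(t <- subvecs my) \sum_(s <- subvecs mx)
      f (t ++ s) * g (vsub my t ++ vsub mx s))%R.
Proof. exact: (sum_subvecs_cat (fun z z' => f z * g z')%R). Qed.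

(** Leading parts multiply: in extremal degree only the splitting of [mx] that is extremal for each
    factor survives. *)
Lemma polyprod_top d (ls : seq P) (my mx : seq nat) : size mx = d ->
  (\sum_(l <- ls) topsz d l < sumn mx ->
     polyprod [seq @kos M l | l <- ls] (my ++ mx) = 0%R) /\
  (sumn mx = \sum_(l <- ls) topsz d l ->
     polyprod [seq @kos M l | l <- ls] (my ++ mx) =
     (polyprod [seq kos (ptop d l) | l <- ls] mx
      * polyprod [seq kos (prest d l) | l <- ls] my)%R).
Proof.
elim: ls my mx => [|l ls IH] my mx Ed /=.
  rewrite !big_nil /poly1 all_cat; split=> [lt|E].
    by rewrite [all _ mx](_ : _ = false) ?andbF //; elim: mx lt {Ed} => //= -[].
  have -> : all (eq_op^~ 0) mx = true by elim: mx E {Ed} => //= -[].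
  by rewrite andbT mul1r.
rewrite !big_cons polymul_cat /polymul; split=> [lt|E].
  rewrite big1_seq // => t _; rewrite big1_seq // => s /andP[_ /subvecsP[E1 E2 E3]].
  have [K0 _] := @kos_top d l t s (etrans E1 Ed).
  have [K1 _] := IH (vsub my t) (vsub mx s) (etrans E2 Ed).
  have [lt'|le'] := ltnP (topsz d l) (sumn s); first by rewrite K0 ?mul0r.
  by rewrite K1 ?mulr0 //; lia.
rewrite mulr_suml exchange_big /=; apply: eq_big_seq => s /subvecsP[E1 E2 E3].
rewrite mulr_sumr; apply: eq_big_seq => t _.
have [K0 K0'] := @kos_top d l t s (etrans E1 Ed).
have [K1 K1'] := IH (vsub my t) (vsub mx s) (etrans E2 Ed).
have [lt'|lt'|Es] := ltngtP (topsz d l) (sumn s).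
- rewrite K0 // mul0r; have [->|/kos_psz] := eqVneq (kos (ptop d l) s) 0%R; first by rewrite !mul0r.
  by rewrite psz_ptop; lia.
- rewrite K1 ?mulr0; last by lia.
  have [->|/kos_psz] := eqVneq (kos (ptop d l) s) 0%R; first by rewrite !mul0r.
  by rewrite psz_ptop; lia.
by rewrite K0' ?K1' //; [ring|lia].
Qed.

(** Linear independence in each group of variables in turn. The [M] variables of [my] separate all
    partitions in the square, the [d] variables of [mx] those with at most [d] rows. *)
Lemma kos_free2 d (w : P -> P -> int) :
  (forall mx my : seq nat, size mx = d -> size my = M -> sumn mx + sumn my <= M ->
     (\sum_q \sum_n w q n * kos q mx * kos n my = 0)%R) ->
  forall q n, q d = 0 -> psz q + psz n <= M -> w q n = 0%R.
Proof.
move=> w0 q n q0 le_qn.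
apply: (@kos_free M (M - psz q) (w q)); [|by lia|exact: prow_out].
move=> my Emy lemy; apply: (@kos_free d (M - sumn my) (fun q => spoly (w q) my)); [|by lia|by []].
move=> mx Emx lemx; rewrite -[RHS](w0 mx my) //; last by lia.
rewrite {1}/spoly; apply: eq_bigr => q' _; rewrite /spoly mulr_suml.
by apply: eq_bigr => n' _; rewrite mulrAC.
Qed.

Lemma ptop_prest_inj d l n : ptop d l = ptop d n -> prest d l = prest d n -> l = n.
Proof.
move=> Et Er; apply: ptnP => i _; case: (ltnP i d) => lt.
  by have := ptopE d l i; rewrite Et ptopE lt.
by rewrite -(subnKC lt) -!prestE Er.
Qed.

Lemma sum_top_rest d (Q : pred P) (f : V) (G : P -> P -> int) :
  (\sum_q \sum_n (\sum_(l | Q l && ((ptop d l == q) && (prest d l == n))) f l) * G q n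
   = \sum_(l | Q l) f l * G (ptop d l) (prest d l))%R.
Proof.
rewrite [RHS](partition_big (fun l => (ptop d l, prest d l)) xpredT) // pair_big /=.
apply: eq_bigr => -[q n] _ /=; rewrite mulr_suml; apply: eq_big => [l|l].
  by rewrite xpair_eqE.
by move=> /andP[_ /andP[/eqP-> /eqP->]].
Qed.

Lemma lead_step d (ls : seq P) X (D := \sum_(l <- ls) topsz d l) :
  D <= X ->
  (forall n, psz n <= M -> X < topsz d n -> lrc ls n = 0%R) ->
  forall n, psz n <= M -> topsz d n = X ->
  lrc ls n = ((X == D)%:R * (lrc [seq ptop d l | l <- ls] (ptop d n)
                             * lrc [seq prest d l | l <- ls] (prest d n)))%R.
Proof.
move=> leDX big0 n0 len0 En0.
pose Q n := (topsz d n == X) && (psz n <= M).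
(* The factor testing [psz q == X] makes both sides vanish when the degree of [mx] is not [X]. *)
pose rhs q n := ((X == D)%:R * ((psz q == X)%:R * lrc [seq ptop d l | l <- ls] q
                             * lrc [seq prest d l | l <- ls] n))%R.
pose w q n := (\sum_(l | Q l && ((ptop d l == q) && (prest d l == n))) lrc ls l - rhs q n)%R.
have w0 : w (ptop d n0) (prest d n0) = 0%R; last first.
  move: w0; rewrite /w (big_pred1 n0) => [/eqP|l]; last first.
    apply/andP/eqP => [[_ /andP[/eqP Et /eqP Er]]|->]; first exact: ptop_prest_inj Et Er.
    by rewrite /Q En0 !eqxx len0.
  by rewrite subr_eq0 /rhs psz_ptop En0 eqxx mul1r => /eqP.
apply: (@kos_free2 d); [|by rewrite ptopE ltnn|by rewrite psz_ptop psz_prest].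
move=> mx my Emx Emy lexy.
transitivity (\sum_(l | Q l) lrc ls l * (kos (ptop d l) mx * kos (prest d l) my)
     - \sum_q \sum_n rhs q n * (kos q mx * kos n my) : int)%R.
  rewrite -(sum_top_rest d Q (lrc ls) (fun q n => kos q mx * kos n my)%R) -sumrB.
  apply: eq_bigr => q _; rewrite -sumrB; apply: eq_bigr => n _.
  by rewrite /w -mulrA mulrBl.
have [Ex|nex] := eqVneq (sumn mx) X; last first.
  rewrite big1 => [|l /andP[/eqP El _]]; last first.
    have [->|/kos_psz] := eqVneq (kos (ptop d l) mx) 0%R; first by rewrite mul0r mulr0.
    by rewrite psz_ptop El => E; rewrite E eqxx in nex.
  rewrite big1 ?subr0 // => q _; rewrite big1 // => n _.
  have [->|/kos_psz E] := eqVneq (kos q mx) 0%R; first by rewrite mul0r mulr0.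
  by rewrite /rhs E (negPf nex) !(mul0r, mulr0).
transitivity (polyprod [seq @kos M l | l <- ls] (my ++ mx)
     - (X == D)%:R * (polyprod [seq kos (ptop d l) | l <- ls] mx
      * polyprod [seq kos (prest d l) | l <- ls] my))%R; last first.
  have [K0 K1] := @polyprod_top d ls my mx Emx.
  case: (X =P D) => [E|/eqP ne]; first by rewrite K1 ?mul1r ?subrr // Ex.
  by rewrite K0 ?mul0r ?subr0 // Ex ltn_neqAle eq_sym ne.
congr (_ - _)%R.
  rewrite polyprod_lrc ?sumn_cat 1?addnC // /spoly big_mkcond /=; apply: eq_bigr => l _.
  have [K0 K1] := @kos_top d l my mx Emx.
  have [/andP[/eqP Et _]|nQ] := boolP (Q l); first by rewrite K1 // Ex.
  have [->|ne] := eqVneq (kos l (my ++ mx)) 0%R; first by rewrite mulr0.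
  have lel : psz l <= M by rewrite (kos_psz ne) sumn_cat addnC.
  have [lt|lt|E] := ltngtP (topsz d l) X.
  - by rewrite K0 ?mulr0 // Ex.
  - by rewrite big0 ?mul0r.
  - by move: nQ; rewrite /Q E eqxx lel.
rewrite (map_comp (@kos M) (ptop d)) (map_comp (@kos M) (prest d)) !polyprod_lrc //; [|lia|lia].
rewrite /spoly mulr_suml mulr_sumr; apply: eq_bigr => q _.
rewrite mulr_sumr mulr_sumr; apply: eq_bigr => n _; rewrite /rhs.
have [->|/kos_psz ->] := eqVneq (kos q mx) 0%R; first by ring.
by rewrite Ex eqxx /=; ring.
Qed.

Lemma topsz_le_psz d l : topsz d l <= psz l.
Proof. by rewrite -(psz_prest d l) leq_addr. Qed.

(** Descending induction on [topsz d n], which is at most [M]: each use of [lead_step] clears one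
    degree. *)
Lemma lrc_top_vanish d (ls : seq P) n : psz n <= M ->
  \sum_(l <- ls) topsz d l < topsz d n -> lrc ls n = 0%R.
Proof.
have gen N : forall n, psz n <= M -> \sum_(l <- ls) topsz d l < topsz d n ->
    M < topsz d n + N -> lrc ls n = 0%R.
  elim: N => [|N IHN] {}n leM ltD ltN; first by have := topsz_le_psz d n; lia.
  rewrite (@lead_step d ls (topsz d n)) //; first by rewrite gtn_eqF ?mul0r.
    exact: ltnW.
  by move=> m lem ltm; apply: IHN => //; lia.
by move=> leM ltD; apply: (gen M.+1) => //; lia.
Qed.

Lemma lrc_top d (ls : seq P) n : psz n <= M ->
  topsz d n = \sum_(l <- ls) topsz d l ->
  lrc ls n = (lrc [seq ptop d l | l <- ls] (ptop d n)
              * lrc [seq prest d l | l <- ls] (prest d n))%R.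
Proof.
move=> leM E; rewrite [LHS](@lead_step d ls (topsz d n)) // ?E ?eqxx ?mul1r //.
by move=> m lem; exact: lrc_top_vanish.
Qed.

Lemma polyprod_homog (ls : seq P) s :
  polyprod [seq @kos M l | l <- ls] s != 0%R -> sumn s = \sum_(l <- ls) psz l.
Proof.
elim: ls s => [|l ls IH] s /=.
  by rewrite big_nil /poly1; case: ifP; rewrite ?eqxx // => + _; elim: s => //= -[].
apply: contraNeq; rewrite big_cons => ne; rewrite /polymul big1_seq // => t /andP[_ /subvecsP[_ _ E]].
have [->|/kos_psz El] := eqVneq (kos l t) 0%R; first by rewrite mul0r.
have [->|/IH Es] := eqVneq (polyprod [seq @kos M l | l <- ls] (vsub s t)) 0%R; first by rewrite mulr0.
by case/eqP: ne; rewrite El -Es.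
Qed.

(** The part of [lrc ls] off the expected degree has the zero polynomial, because the product is
    homogeneous; linear independence does the rest. *)
Lemma lrc_homog (ls : seq P) n : psz n <= M -> lrc ls n != 0%R ->
  psz n = \sum_(l <- ls) psz l.
Proof.
move=> leM; apply: contraNeq => ne.
suff : (if psz n == \sum_(l <- ls) psz l then 0 else lrc ls n)%R = 0%R.
  by rewrite (negPf ne) => ->.
apply: (@kos_free M M (fun n => if psz n == \sum_(l <- ls) psz l then 0 else lrc ls n)%R) => //;
  last exact: prow_out.
move=> s _ les; have [Es|nes] := eqVneq (sumn s) (\sum_(l <- ls) psz l).
  rewrite (@eq_spoly _ _ (fun=> 0%R)) => [|l ->]; last by rewrite Es eqxx.
  by rewrite /spoly big1 // => l _; rewrite mul0r.
rewrite (@eq_spoly _ _ (lrc ls)) => [|l ->]; last by rewrite (negPf nes).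
by rewrite -polyprod_lrc //; apply/eqP; apply: contraNT nes => /polyprod_homog ->.
Qed.

(* Dominance over the union of the shapes: the bound on the first columns, taken at
   column [n a], turns into a bound on the first [a] rows. *)
Lemma lrc_rows (zs : seq (nat * P)) n (a := \sum_(z <- zs) z.1) : psz n <= M ->
  lrc [seq z.2 | z <- zs] n != 0%R ->
  \sum_(z <- zs) topsz z.1 z.2 <= topsz a n.
Proof.
move=> leM nz; set t := n a.
have Esz := lrc_homog leM nz; rewrite big_map in Esz.
(* The vanishing lemma for the conjugates: the first [t] columns of [n] hold at most as many boxes
   as those of all factors together. *)
have le_t : topsz t (conj n) <= \sum_(z <- zs) topsz t (conj z.2).
  rewrite leqNgt; apply/negP => lt; case/eqP: nz; rewrite -lrc_conj -map_comp.
  by apply: (@lrc_top_vanish t); rewrite ?psz_conj // big_map.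
have E1 l : psz l = topsz t (conj l) + \sum_(j < M) (l j - t).
  by rewrite /topsz sum_conj -big_split; apply: eq_bigr => j _ /=; lia.
have E2 l x : topsz x l <= x * t + \sum_(j < M) (l j - t).
  apply: (@leq_trans (\sum_(i < x) (t + (l i - t)))); first by apply: leq_sum => i _; lia.
  rewrite big_split /= -mul_sum_ord leq_add2l.
  by apply: (@sum_ord_vanish M x (fun j => l j - t)) => i /prow_out->.
(* The choice [t = n a] makes the bound [E2] sharp for [n]: its first [a] rows have length at least
   [t], the later ones at most [t]. *)
have E3 : a * t + \sum_(j < M) (n j - t) <= topsz a n.
  apply: (@leq_trans (a * t + \sum_(j < a) (n j - t))).
    rewrite leq_add2l; apply: (@sum_ord_vanish a M (fun j => n j - t)) => i /(prow_dec n).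
    by rewrite -/t; lia.
  rewrite mul_sum_ord -big_split; apply: leq_sum => i _ /=.
  by have := prow_dec n (ltnW (ltn_ord i)); rewrite -/t; lia.
apply: leq_trans E3; move: (E1 n) Esz; under eq_bigr => z _ do rewrite (E1 z.2).
rewrite big_split /= => EA EB.
apply: (@leq_trans (\sum_(z <- zs) (z.1 * t + \sum_(j < M) (z.2 j - t)))).
  by apply: leq_sum => z _; exact: E2.
rewrite big_split /= -big_distrl /= -/a leq_add2l; lia.
Qed.

End Leading.

(** * Removing full columns *)

Section Columns.
Variables M d : nat.
Hypothesis led : d <= M.
Local Notation P := (ptn M).
Local Notation V := (ptn M -> int).
Local Notation e0 := (basis (ptn0 M)).
Implicit Types (l m n q : P) (u v : V) (T S : V -> V).

(** Equality of symmetric polynomials in [d] variables, where Schur functions with more than [d]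
    rows vanish and the elementary function of degree [d] is the product of the variables. *)
Definition eqd u v := forall n, n d = 0 -> u n = v n.

Lemma alg_eqd T u v : alg T -> eqd u v -> eqd (T u) (T v).
Proof.
move=> aT E; elim: aT => {T} [//|k T _ IH|c T S _ IHT _ IHS] n nd; last first.
  by rewrite IHT ?IHS.
apply: eq_bigr => m /andP[/hsP h _]; apply: IH; have := h d; lia.
Qed.

Lemma alg_eqd_e0 T S v : alg T -> alg S -> eqd (T e0) (S e0) -> eqd (T v) (S v).
Proof.
move=> aT aS E n nd; rewrite (alg_expand v n aT) (alg_expand v n aS).
apply: eq_bigr => l _; congr (_ * _)%R; rewrite -Mop_e0.
rewrite (alg_comm _ aT (alg_Mop l)) (alg_comm _ aS (alg_Mop l)).
by apply: alg_eqd => //; exact: alg_Mop.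
Qed.

Definition addbox k l : P := mkptn M (fun i => if i < d then l i + k else 0).

Lemma addboxE k l i : l 0 + k <= M -> addbox k l i = if i < d then l i + k else 0.
Proof.
move=> leM; apply: mkptnE; split=> [j||].
- by have := prowS l j; case: ifP; case: ifP; lia.
- by case: ifP => // _; lia.
by rewrite ltnNge led.
Qed.

Lemma psz_addbox k l : l 0 + k <= M -> l d = 0 -> psz (addbox k l) = psz l + d * k.
Proof.
move=> leM ld; rewrite (@psz_short _ d) ?addboxE ?ltnn // (@psz_short _ d l) //.
rewrite mul_sum_ord -big_split; apply: eq_bigr => i _ /=.
by rewrite addboxE // ltn_ord.
Qed.

Lemma addbox0 l : l d = 0 -> addbox 0 l = l.
Proof.
move=> ld; apply: ptnP => i _; rewrite addboxE ?addn0 ?prow_max //.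
by case: ltnP => // /(prow_dec l); lia.
Qed.

Lemma addboxS k l : l 0 + k.+1 <= M -> addbox 1 (addbox k l) = addbox k.+1 l.
Proof.
move=> leM; have lk : l 0 + k <= M by lia.
by apply: ptnP => i _; rewrite !addboxE //; [case: (i < d) | case: ifP]; lia.
Qed.

Lemma Eop_basis l : l 0 < M -> l d = 0 -> eqd (Eop d (basis l)) (basis (addbox 1 l)).
Proof.
move=> l0 ld n nd; have lM : l 0 + 1 <= M by lia.
transitivity ((vs n l && (psz n == psz l + d))%:R : int)%R.
  rewrite /Eop; case: (boolP (_ && _)) => h.
    rewrite (bigD1 l) //= {1}/basis eqxx big1 ?addr0 // => m /andP[_ ne].
    by rewrite /basis (negPf ne).
  rewrite big1 // => m /andP[h1 E]; rewrite /basis; case: eqP => // Em.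
  by move: h; rewrite -Em h1 E.
rewrite /basis; congr (nat_of_bool _)%:R%R; apply/andP/eqP => [[/vsP h /eqP E]|->].
  apply: sub_psz_eq; last by rewrite psz_addbox // muln1.
  by move=> i; rewrite addboxE //; case: ltnP => [_|/(prow_dec n)]; have := h i; lia.
split; last by rewrite psz_addbox // muln1.
by apply/vsP => i; rewrite addboxE //; case: ltnP => [_|/(prow_dec l)]; lia.
Qed.

(** A vertical strip takes at most one box from each of the [d] rows of [addbox 1 l], so one of size
    [d] leaves exactly [l]. *)
Lemma Eop_addbox v l : l 0 < M -> l d = 0 -> Eop d v (addbox 1 l) = v l.
Proof.
move=> l0 ld; have lM : l 0 + 1 <= M by lia.
rewrite /Eop (big_pred1 l) // => m; rewrite psz_addbox // muln1.
apply/andP/eqP => [[/vsP h /eqP E]|->]; last first.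
  split=> //; apply/vsP => i; rewrite addboxE //.
  by case: ltnP => [_|/(prow_dec l)]; lia.
apply/esym/sub_psz_eq; last by lia.
by move=> i; have := h i; rewrite addboxE //; case: ltnP => [_|/(prow_dec l)]; lia.
Qed.

(** In [d] variables each full column is a factor [Eop d]; by [alg_eqd_e0] it is enough to compare
    the operators at [e0]. *)
Lemma Mop_addbox k l v : l 0 + k <= M -> l d = 0 ->
  eqd (Mop (addbox k l) v) (iter k (@Eop M d) (Mop l v)).
Proof.
move=> leM ld; elim: k leM v => [|k IH] leM v; first by rewrite addbox0.
have lk : l 0 + k <= M by lia.
have := @alg_eqd_e0 (Mop (addbox k.+1 l)) (fun v => Eop d (Mop (addbox k l) v)) v.
move=> E n nd; rewrite /= E //.
- by apply: alg_eqd nd => //; [exact: alg_Eop | exact: IH].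
- exact: alg_Mop.
- exact: alg_comp (alg_Eop M d) (alg_Mop _).
rewrite !Mop_e0 -addboxS // => m md; rewrite Eop_basis //.
  by rewrite addboxE //; case: ifP; lia.
by rewrite addboxE // ltnn.
Qed.

Lemma alg_iter_Eop k : alg (iter k (@Eop M d)).
Proof.
elim: k => [|k IH]; first exact: alg_id.
exact: alg_comp (alg_Eop M d) IH.
Qed.

(** Each factor gives up its full columns as powers of [Eop d]. These commute to the front, where
    [Eop_addbox] cancels them against the columns of the target. *)
Lemma lrc_addbox (zs : seq (nat * P)) n (K := \sum_(z <- zs) z.1) :
  (forall z, z \in zs -> (z.2 0 + z.1 <= M) && (z.2 d == 0)) ->
  n d = 0 -> n 0 + K <= M ->
  lrc [seq addbox z.1 z.2 | z <- zs] (addbox K n) = lrc [seq z.2 | z <- zs] n.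
Proof.
move=> zsP nd leM.
have E : eqd (lrc [seq addbox z.1 z.2 | z <- zs])
             (iter K (@Eop M d) (lrc [seq z.2 | z <- zs])).
  rewrite /K; elim: zs zsP {K leM} => [|z zs IH] zsP; first by rewrite big_nil.
  rewrite /lrc /= -!/(lrc _) big_cons => m md.
  have /andP[z0 /eqP zd] := zsP z (mem_head _ _).
  rewrite Mop_addbox // iterD.
  rewrite (alg_comm _ (alg_iter_Eop z.1) (alg_Mop _)).
  rewrite [in RHS](alg_comm _ (alg_iter_Eop _) (alg_Mop z.2)).
  rewrite (alg_comm _ (alg_iter_Eop z.1) (alg_Mop _)).
  do 2!(apply: alg_eqd => //; first by [exact: alg_Mop | exact: alg_iter_Eop]).
  by apply: IH => y yzs; apply: zsP; rewrite in_cons yzs orbT.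
rewrite E; last by rewrite addboxE // ltnn.
elim: (K) leM => [|k IH] leM; first by rewrite addbox0.
have lk : n 0 + k <= M by lia.
rewrite /= -addboxS // Eop_addbox; first exact: IH.
  by rewrite addboxE //; case: ifP; lia.
by rewrite addboxE // ltnn.
Qed.

End Columns.

(** * Composition *)

Section Corner.
Variable M : nat.
Local Notation P := (ptn M).
Implicit Types (l m n q : P).

(* Both kinds of composed conditions have this shape: the [x] by [e] rectangle with
   [m] attached on its right and [l] below it. *)
Definition corner (x e : nat) m l : P :=
  mkptn M (fun i => if i < x then e + m i else l (i - x)).

Lemma conj_eq0 l e : l 0 <= e -> conj l e = 0.
Proof. by move=> le; apply/eqP; rewrite -leqn0 leqNgt conjP -leqNgt. Qed.

Lemma conj_max l x : x <= M -> l (M - x) = 0 -> conj l 0 + x <= M.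
Proof.
by move=> lex l0; have : conj l 0 <= M - x; [rewrite leqNgt conjP l0 | lia].
Qed.

Section CornerTheory.
Variables (x e : nat) (m l : P).
Hypotheses (lex : x <= M) (lee : e + m 0 <= M) (le_le : l 0 <= e).
Hypotheses (l_len : l (M - x) = 0) (m_len : m x = 0).

Lemma cornerE i : corner x e m l i = if i < x then e + m i else l (i - x).
Proof.
apply: mkptnE; split=> [j||].
- case: (ltnP j x) => lt; last by rewrite ifN ?subSn ?prowS // -leqNgt ltnW.
  case: ltnP => lt'; first by rewrite leq_add2l prowS.
  by rewrite (_ : j.+1 - x = 0); lia.
- by case: ifP => // _; rewrite sub0n; lia.
by rewrite ltnNge lex.
Qed.

Lemma ptop_corner : ptop x (corner x e m l) = addbox x e m.
Proof.
apply: ptnP => i _; rewrite ptopE addboxE 1?addnC // cornerE.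
by case: ltnP => // _; rewrite addnC.
Qed.

Lemma prest_corner : prest x (corner x e m l) = l.
Proof. by apply: ptnP => i _; rewrite prestE cornerE ltnNge leq_addr /= addKn. Qed.

Lemma topsz_corner : topsz x (corner x e m l) = psz m + x * e.
Proof. by rewrite -psz_ptop ptop_corner psz_addbox // addnC. Qed.

(** Transposing a corner exchanges the two attached partitions and the two sides of the rectangle,
    so its first [e] columns can be split off as its first [x] rows are. *)
Lemma ptop_conj_corner : ptop e (conj (corner x e m l)) = addbox e x (conj l).
Proof.
have lee' : e <= M by lia.
apply: ptnP => i _; rewrite ptopE addboxE ?conj_max //.
case: ltnP => // lt; apply: ltn_ext => k; rewrite conjP cornerE.
case: (ltnP k x) => ltk; first by lia.
by have := conjP l (k - x) i; lia.
Qed.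

Lemma prest_conj_corner : prest e (conj (corner x e m l)) = conj m.
Proof.
apply: ptnP => i _; apply: ltn_ext => k; rewrite prestE.
rewrite (conjP (corner x e m l)) (conjP m) cornerE.
case: (ltnP k x) => ltk; first by rewrite ltn_add2l.
by have := prow_dec m ltk; have := prow_dec l (leq0n (k - x)); lia.
Qed.

Lemma topsz_conj_corner : topsz e (conj (corner x e m l)) = psz l + e * x.
Proof.
rewrite -psz_ptop ptop_conj_corner psz_addbox ?psz_conj ?conj_max ?conj_eq0 //; lia.
Qed.

Lemma psz_corner : psz (corner x e m l) = psz m + x * e + psz l.
Proof. by rewrite -(psz_prest x) topsz_corner prest_corner. Qed.

End CornerTheory.

Lemma sum_distr (I : Type) (s : seq I) (f g : I -> nat) k :
  \sum_(i <- s) (f i + k * g i) = \sum_(i <- s) f i + k * \sum_(i <- s) g i.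
Proof. by rewrite big_split big_distrr. Qed.

Lemma leq_big (I : eqType) (s : seq I) (f : I -> nat) i :
  i \in s -> f i <= \sum_(j <- s) f j.
Proof.
elim: s => // j s IH; rewrite in_cons big_cons => /orP[/eqP<-|/IH]; first exact: leq_addr.
by move=> le; apply: leq_trans le (leq_addl _ _).
Qed.

(** * The product of the composed conditions in the large rectangle *)

Section Compose.
Variables a b c d : nat.
(** The entries of [X] are the triples of [a_i], [mu^i], [alpha^i]; those of [Z] are the triples of
    [b_j], [nu^j], [beta^j], together with triples that encode the conditions [gamma^k]. *)
Variables X Z : seq (nat * P * P).
Hypotheses (c_gt0 : 0 < c) (d_gt0 : 0 < d) (leM : (a + c) * (b + d) <= M).
Hypothesis XP : forall z, z \in X ->
  [&& z.1.2 z.1.1 == 0, z.1.2 0 <= b, z.2 0 <= d & z.2 c == 0].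
Hypothesis ZP : forall z, z \in Z ->
  [&& z.1.2 0 <= z.1.1, z.1.2 a == 0, z.2 0 <= d & z.2 c == 0].
Hypotheses (sumX : \sum_(z <- X) z.1.1 = a) (sumZ : \sum_(z <- Z) z.1.1 = b).
Hypothesis sum1 : \sum_(z <- X) psz z.1.2 + \sum_(z <- Z) psz z.1.2 = a * b.
Hypothesis sum2 : \sum_(z <- X) psz z.2 + \sum_(z <- Z) psz z.2 = c * d.

Let A := a + c.
Let B := b + d.
Let cX z := corner z.1.1 d z.1.2 z.2.
Let cZ z := corner c z.1.1 z.2 z.1.2.

Let leA : A <= M.
Proof. by apply: leq_trans leM; rewrite leq_pmulr // addn_gt0 d_gt0 orbT. Qed.
Let leB : B <= M.
Proof. by apply: leq_trans leM; rewrite leq_pmull // addn_gt0 c_gt0 orbT. Qed.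

Let hX z : z \in X -> [/\ z.1.1 <= M, d + z.1.2 0 <= M, z.2 0 <= d,
                          z.2 (M - z.1.1) = 0 & z.1.2 z.1.1 = 0].
Proof.
move=> zX; have /and4P[/eqP h1 h2 h3 /eqP h4] := XP zX.
have := @leq_big _ X (fun z => z.1.1) z zX; rewrite sumX => h5.
have := leA; have := leB; rewrite /A /B => hB hA; split=> //; try lia.
by have : z.2 (M - z.1.1) <= z.2 c; [apply: prow_dec; lia | lia].
Qed.

Let hZ z : z \in Z -> [/\ c <= M, z.1.1 + z.2 0 <= M, z.1.2 0 <= z.1.1,
                          z.1.2 (M - c) = 0 & z.2 c = 0].
Proof.
move=> zZ; have /and4P[h1 /eqP h2 h3 /eqP h4] := ZP zZ.
have := @leq_big _ Z (fun z => z.1.1) z zZ; rewrite sumZ => h5.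
have := leA; have := leB; rewrite /A /B => hB hA; split=> //; try lia.
by have : z.1.2 (M - c) <= z.1.2 a; [apply: prow_dec; lia | lia].
Qed.

Let inboxAB_psz n : inbox A B n -> psz n <= M.
Proof. by move=> /(psz_compl leA leB); move: leM; rewrite -/A -/B; lia. Qed.

(** The squeeze: [h4] bounds the first [a] rows of [n] from below, [hsum] bounds them from above,
    and equality forces the corner shape. *)
Lemma compose_bad n : inbox A B n ->
  lrc [seq cX z | z <- X] n != 0%R -> lrc [seq cZ z | z <- Z] (compl A B n) != 0%R ->
  (forall i, i < a -> d <= n i) /\ n a <= d.
Proof.
move=> bn nzX nzZ; have lenM := inboxAB_psz bn.
have h1 : \sum_(z <- X) psz z.1.2 + d * a <= topsz a n.
  have := @lrc_rows M [seq (z.1.1, cX z) | z <- X] n lenM.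
  rewrite -map_comp !big_map /= sumX => /(_ nzX); apply: leq_trans.
  rewrite -sumX -sum_distr; apply: eq_leq; apply: eq_big_seq => z /hX[? ? ? ? ?].
  by rewrite topsz_corner // mulnC.
have h2 : \sum_(z <- Z) psz z.1.2 + c * b <= topsz b (conj (compl A B n)).
  have := @lrc_rows M [seq (z.1.1, conj (cZ z)) | z <- Z] (conj (compl A B n)).
  have nzZ' := nzZ; rewrite -lrc_conj -map_comp in nzZ'.
  rewrite -map_comp !big_map /= sumZ psz_conj.
  move=> /(_ (inboxAB_psz (inbox_compl leA leB n)) nzZ'); apply: leq_trans.
  rewrite -sumZ -sum_distr; apply: eq_leq; apply: eq_big_seq => z /hZ[? ? ? ? ?].
  by rewrite topsz_conj_corner // mulnC.
(* Row by row, the boxes of the complement in its first [b] columns and the boxes of [n] beyond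
   column [d] fill a row of length [b]. *)
have h3 : topsz b (conj (compl A B n)) + \sum_(i < A) (n i - d) <= A * b.
  apply: (@leq_trans (\sum_(i < A) minn (B - n i) b + \sum_(i < A) (n i - d))).
    rewrite leq_add2r /topsz sum_conj.
    apply: leq_trans (@sum_ord_vanish A M (fun i => minn (compl A B n i) b) _) _.
      by move=> i le; rewrite complE // ltnNge le min0n.
    rewrite [X in _ <= X](reindex_inj rev_ord_inj) /=; apply: eq_leq; apply: eq_bigr => i _.
    by rewrite complE // ltn_ord.
  rewrite -big_split (mul_sum_ord A b); apply: leq_sum => i _ /=.
  by have /inboxP/(_ i) := bn; rewrite ltn_ord /B; lia.
(* By [h2] and [h3] at most [a * b] minus the sizes of the [nu^j] boxes lie beyond column [d]. By
   [sum1] this is the total size of the [mu^i], which [h1] bounds. *)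
have h4 : \sum_(i < A) (n i - d) + d * a <= topsz a n.
  by move: h1 h2 h3 sum1; rewrite /A; lia.
have aA : a < A by rewrite /A; lia.
have hsum : topsz a n <= d * a + \sum_(i < a) (n i - d).
  rewrite mulnC mul_sum_ord -big_split; apply: leq_sum => i _ /=; lia.
split=> [i lti|]; rewrite leqNgt; apply/negP => lt.
  have := @sum_ord_leq a A (fun i => n i - d) (ltnW aA).
  suff : topsz a n < d * a + \sum_(i < a) (n i - d) by lia.
  rewrite mulnC mul_sum_ord -big_split /topsz.
  rewrite (bigD1 (Ordinal lti)) //= [X in _ < X](bigD1 (Ordinal lti)) //= -addSn.
  apply: leq_add; first by lia.
  by apply: leq_sum => j _; lia.
have := @sum_ord_leq a.+1 A (fun i => n i - d) aA; rewrite big_ord_recr /= => h5.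
have := leq_trans (leq_trans (leq_add h5 (leqnn (d * a))) h4) hsum.
by rewrite [d * a + _]addnC leq_add2r -[X in _ <= X]addn0 leq_add2l leqn0 subn_eq0 leqNgt lt.
Qed.

Let mu_of n : P := mkptn M (fun i => n i - d).

Let mu_ofE n i : mu_of n i = n i - d.
Proof.
apply: mkptnE; split=> [j||]; first by have := prowS n j; lia.
  by have := prow_max n 0; lia.
by rewrite prow_out.
Qed.

Let boxes m l : inbox a b m -> inbox c d l ->
  [/\ a <= M, d + m 0 <= M, l 0 <= d, l (M - a) = 0 & m a = 0].
Proof.
move=> /andP[m0 /eqP ma] /andP[l0 /eqP lc]; have := leA; have := leB; rewrite /A /B => hB hA.
split=> //; try lia.
by have : l (M - a) <= l c; [apply: prow_dec; lia | lia].
Qed.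

Let lea : a <= M. Proof. by have := leA; rewrite /A; lia. Qed.
Let leb : b <= M. Proof. by have := leB; rewrite /B; lia. Qed.
Let lec : c <= M. Proof. by have := leA; rewrite /A; lia. Qed.
Let led : d <= M. Proof. by have := leB; rewrite /B; lia. Qed.

Let coboxes m l : inbox a b m -> inbox c d l ->
  [/\ c <= M, b + compl c d l 0 <= M, compl a b m 0 <= b,
      compl a b m (M - c) = 0 & compl c d l c = 0].
Proof.
move=> bm bl; have /andP[m0 /eqP ma] := inbox_compl lea leb m.
have /andP[l0 /eqP lc] := inbox_compl lec led l.
have := leA; have := leB; rewrite /A /B => hB hA; split=> //; try lia.
have : compl a b m (M - c) <= compl a b m a; [apply: prow_dec; lia | lia].
Qed.

(** A half turn of the large rectangle brings its empty [c] by [b] block to the top left as the new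
    full one, and exchanges the blocks that hold [m] and [l]. *)
Lemma compl_corner m l : inbox a b m -> inbox c d l ->
  compl A B (corner a d m l) = corner c b (compl c d l) (compl a b m).
Proof.
move=> bm bl; have [h1 h2 h3 h4 h5] := boxes bm bl.
have [k1 k2 k3 k4 k5] := coboxes bm bl.
apply: ptnP => i _; rewrite (complE leA leB) (cornerE k1 k2 k3 k4 k5).
rewrite (cornerE h1 h2 h3 h4 h5).
rewrite (complE lec led l) (complE lea leb m).
have /inboxP hm := bm; have /inboxP hl := bl; rewrite /A /B.
case: (ltnP i c) => lt; last first.
  case: (ltnP i (a + c)) => lt2; last by rewrite ifN // -leqNgt; lia.
  rewrite !ifT; try lia.
  by rewrite (_ : a + c - i.+1 = a - (i - c).+1); lia.
rewrite ifT ?ifN -?leqNgt; try lia.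
rewrite (_ : a + c - i.+1 - a = c - i.+1); last by lia.
by have := hl (c - i.+1); rewrite ifT; lia.
Qed.

Lemma inbox_corner m l : inbox a b m -> inbox c d l -> inbox A B (corner a d m l).
Proof.
move=> bm bl; have [h1 h2 h3 h4 h5] := boxes bm bl.
apply/inboxP => i; rewrite (cornerE h1 h2 h3 h4 h5).
have /inboxP/(_ i) hm := bm; have /inboxP/(_ (i - a)) hl := bl; move: hm hl; rewrite /A /B.
case: (ltnP i a) => lt; first by rewrite (_ : i < a + c); lia.
by case: ifP; case: ifP; lia.
Qed.

Lemma sum_corner (G : P -> int) :
  (forall n, inbox A B n -> ~ ((forall i, (i < a)%N -> (d <= n i)%N) /\ (n a <= d)%N) -> G n = 0%R) ->
  (\sum_(n | inbox A B n) G n =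
   \sum_(m | inbox a b m) \sum_(l | inbox c d l) G (corner a d m l))%R.
Proof.
move=> bad; pose good n := [forall i : 'I_a, d <= n i] && (n a <= d).
have goodP n : reflect ((forall i, i < a -> d <= n i) /\ n a <= d) (good n).
  apply: (iffP andP) => [[/forallP h ha]|[h ha]]; split=> //.
    by move=> i lt; exact: (h (Ordinal lt)).
  by apply/forallP => i; exact: h.
have cornerK n : inbox A B n -> good n ->
    [/\ inbox a b (mu_of n), inbox c d (prest a n) & corner a d (mu_of n) (prest a n) = n].
  move=> bn /goodP[g1 g2]; have /inboxP hn := bn.
  have bm : inbox a b (mu_of n).
    apply/inboxP => i; rewrite mu_ofE; have := hn i; rewrite /A /B.
    by case: (ltnP i a) => lt; [rewrite ifT|have := prow_dec n lt]; lia.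
  have bl : inbox c d (prest a n).
    apply/andP; rewrite !prestE addn0; split=> //.
    by have := hn (a + c); rewrite ltnn; lia.
  have [h1 h2 h3 h4 h5] := boxes bm bl; split=> //.
  apply: ptnP => i _; rewrite (cornerE h1 h2 h3 h4 h5) mu_ofE prestE.
  by case: (ltnP i a) => lt; [have := g1 i lt; lia | rewrite subnKC].
rewrite (bigID good) /= [X in (_ + X)%R]big1 ?addr0; last first.
  by move=> n /andP[bn /goodP]; exact: bad.
rewrite pair_big /=.
apply: (@sum_bij _ _ _ _ _ (fun n => (mu_of n, prest a n))
          (fun p => corner a d p.1 p.2)) => /= [n|[m l]|n].
- by move=> /andP[bn /(cornerK _ bn)[-> -> ->]].
- move=> /= /andP[bm bl]; have [h1 h2 h3 h4 h5] := boxes bm bl.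
  have cE := cornerE h1 h2 h3 h4 h5; split.
    rewrite inbox_corner //; apply/goodP; split=> [i lt|]; rewrite cE.
      by rewrite lt leq_addr.
    by rewrite ltnn subnn.
  congr (_, _); last exact: prest_corner.
  apply: ptnP => i _; rewrite mu_ofE (cornerE h1 h2 h3 h4 h5); case: ltnP => lt; first by rewrite addKn.
  by have := prow_dec m lt; have := prow_dec l (leq0n (i - a)); lia.
- by move=> /andP[bn /(cornerK _ bn)[_ _ ->]].
Qed.

(** The first [d] columns hold [psz l + d * a] boxes in the target, and [d * a] plus the sizes of
    the [alpha^i] in the factors. So [psz l] decides between vanishing and factorization, after
    which [lrc_addbox] removes the rectangles. *)
Lemma lrc_cX m l : inbox a b m -> inbox c d l ->
  (psz l > \sum_(z <- X) psz z.2 -> lrc [seq cX z | z <- X] (corner a d m l) = 0%R) /\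
  (psz l = \sum_(z <- X) psz z.2 -> lrc [seq cX z | z <- X] (corner a d m l)
     = (lrc [seq z.2 | z <- X] l * lrc [seq z.1.2 | z <- X] m)%R).
Proof.
move=> bm bl; have [h1 h2 h3 h4 h5] := boxes bm bl.
have leMn : psz (conj (corner a d m l)) <= M.
  by rewrite psz_conj; apply: inboxAB_psz; exact: inbox_corner.
have Etop : \sum_(n <- [seq conj (cX z) | z <- X]) topsz d n = \sum_(z <- X) psz z.2 + d * a.
  rewrite big_map -sumX -sum_distr; apply: eq_big_seq => z /hX[? ? ? ? ?].
  by rewrite topsz_conj_corner.
rewrite -lrc_conj -map_comp; split=> [lt|El].
  by apply: (@lrc_top_vanish _ d) => //; rewrite Etop topsz_conj_corner //; lia.
rewrite (@lrc_top _ d) //; last by rewrite Etop topsz_conj_corner //; lia.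
rewrite ptop_conj_corner // prest_conj_corner // -!map_comp; congr (_ * _)%R.
  rewrite (eq_in_map _ (fun z => addbox d z.1.1 (conj z.2)) X).1; last first.
    by move=> z /hX[? ? ? ? ?] /=; rewrite ptop_conj_corner.
  have := @lrc_addbox M d led [seq (z.1.1, conj z.2) | z <- X] (conj l).
  rewrite -!map_comp big_map sumX => ->; first exact: (lrc_conj_map X (fun z => z.2)).
  - move=> _ /mapP[z /hX[? ? ? ? ?] ->] /=.
    by rewrite conj_max // conj_eq0.
  - exact: conj_eq0.
  - exact: conj_max.
rewrite (eq_in_map _ (fun z => conj z.1.2) X).1; last first.
  by move=> z /hX[? ? ? ? ?] /=; rewrite prest_conj_corner.
exact: (lrc_conj_map X (fun z => z.1.2)).
Qed.

(** The same argument on the first [c] rows, where [l] now stands to the right of the rectangle. *)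
Lemma lrc_cZ m l : inbox a b m -> inbox c d l ->
  (psz l > \sum_(z <- Z) psz z.2 -> lrc [seq cZ z | z <- Z] (corner c b l m) = 0%R) /\
  (psz l = \sum_(z <- Z) psz z.2 -> lrc [seq cZ z | z <- Z] (corner c b l m)
     = (lrc [seq z.2 | z <- Z] l * lrc [seq z.1.2 | z <- Z] m)%R).
Proof.
(* Applied to the complements of [m] and [l], [coboxes] yields through [complK] the bounds for [m]
   and [l] themselves. *)
move=> bm bl; have [h1 h2 h3 h4 h5] := coboxes (inbox_compl lea leb m) (inbox_compl lec led l).
rewrite !complK // in h2 h3 h4 h5.
have leMn : psz (corner c b l m) <= M.
  rewrite -[l](complK lec led bl) -[m](complK lea leb bm) -compl_corner ?inbox_compl //.
  by apply: inboxAB_psz; exact: inbox_compl.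
have Etop : \sum_(n <- [seq cZ z | z <- Z]) topsz c n = \sum_(z <- Z) psz z.2 + c * b.
  rewrite big_map -sumZ -sum_distr; apply: eq_big_seq => z /hZ[? ? ? ? ?].
  by rewrite topsz_corner.
split=> [lt|El].
  by apply: (@lrc_top_vanish _ c) => //; rewrite Etop topsz_corner //; lia.
rewrite (@lrc_top _ c) //; last by rewrite Etop topsz_corner //; lia.
rewrite ptop_corner // prest_corner // -!map_comp; congr (_ * _)%R.
  rewrite (eq_in_map _ (fun z => addbox c z.1.1 z.2) Z).1; last first.
    by move=> z /hZ[? ? ? ? ?] /=; rewrite ptop_corner.
  have := @lrc_addbox M c lec [seq (z.1.1, z.2) | z <- Z] l.
  rewrite -!map_comp big_map sumZ => -> //=; last by rewrite addnC.
  by move=> _ /mapP[z /hZ[? ? ? ? ?] ->] /=; rewrite addnC; apply/andP; split=> //; apply/eqP.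
rewrite (eq_in_map _ (fun z => z.1.2) Z).1 // => z /hZ[? ? ? ? ?] /=.
by rewrite prest_corner.
Qed.

Theorem lrc_compose :
  lrc ([seq cX z | z <- X] ++ [seq cZ z | z <- Z]) (boxp M A B)
  = (lrc ([seq z.1.2 | z <- X] ++ [seq z.1.2 | z <- Z]) (boxp M a b)
     * lrc ([seq z.2 | z <- X] ++ [seq z.2 | z <- Z]) (boxp M c d))%R.
Proof.
rewrite !lrc_box // sum_corner; last first.
  move=> n bn ngood; have [->|nzX] := eqVneq (lrc [seq cX z | z <- X] n) 0%R.
    by rewrite mul0r.
  have [->|nzZ] := eqVneq (lrc [seq cZ z | z <- Z] (compl A B n)) 0%R; first by rewrite mulr0.
  by case: ngood; exact: compose_bad.
rewrite mulr_suml; apply: eq_bigr => m bm; rewrite mulr_sumr; apply: eq_bigr => l bl.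
rewrite compl_corner //.
have [X0 X1] := lrc_cX bm bl.
have [Z0 Z1] := lrc_cZ (inbox_compl lea leb m) (inbox_compl lec led l).
have El := psz_compl lec led bl.
(* Unless the sizes agree, one factor on the left lies beyond its extremal degree, and on the right
   [l] has the wrong size for the product over [X]. *)
have [lt|lt|E] := ltngtP (psz l) (\sum_(z <- X) psz z.2).
- rewrite Z0 ?mulr0; last by lia.
  have [->|nz] := eqVneq (lrc [seq z.2 | z <- X] l) 0%R; first by rewrite mul0r mulr0.
  by have := lrc_homog _ nz; rewrite big_map; lia.
- rewrite X0 // mul0r.
  have [->|nz] := eqVneq (lrc [seq z.2 | z <- X] l) 0%R; first by rewrite mul0r mulr0.
  by have := lrc_homog _ nz; rewrite big_map; lia.
rewrite X1 // Z1; last by lia.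
ring.
Qed.

End Compose.
End Corner.

(** * Semistandard tableaux *)

Lemma mem_seqs_below len N t : (t \in seqs_below len N) = (size t == len) && all (gtn N) t.
Proof.
elim: len t => [|len IH] t; first by case: t.
apply/allpairsP/idP => [[[x s] /= [x_N s_in ->]]|].
  by move: s_in; rewrite IH /= eqSS => /andP[-> ->]; rewrite mem_iota add0n /= in x_N; rewrite x_N.
case: t => // x s; rewrite /= eqSS => /and3P[sz xN sN]; exists (x, s) => /=.
by rewrite mem_iota IH sz.
Qed.

Lemma seqs_below_uniq len N : uniq (seqs_below len N).
Proof.
elim: len => //= len IH; apply: allpairs_uniq; rewrite ?iota_uniq //.
by move=> [x s] [y t] _ _ /= [-> ->].
Qed.

Lemma mem_fillings sh N (T : seq (seq nat)) :
  (T \in fillings sh N) = (map size T == sh) && all (all (gtn N)) T.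
Proof.
elim: sh T => [|r sh IH] T; first by case: T.
apply/allpairsP/idP => [[[x s] /= [x_N s_in ->]]|].
  move: s_in x_N; rewrite IH mem_seqs_below /= eqseq_cons.
  by move=> /andP[-> ->] /andP[-> ->].
case: T => // x s; rewrite /= eqseq_cons => /andP[/andP[sz szs] /andP[xN sN]].
by exists (x, s) => /=; rewrite mem_seqs_below IH sz xN szs.
Qed.

Lemma fillings_uniq sh N : uniq (fillings sh N).
Proof.
elim: sh => //= r sh IH; apply: allpairs_uniq; rewrite ?seqs_below_uniq //.
by move=> [x s] [y t] _ _ /= [-> ->].
Qed.

Lemma ssytP (T : seq (seq nat)) :
  reflect ((forall i, sorted leq (nth [::] T i)) /\
           (forall i j, j < size (nth [::] T i.+1) ->
              nth 0 (nth [::] T i) j < nth 0 (nth [::] T i.+1) j)) (is_ssyt T).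
Proof.
apply: (iffP andP) => -[h1 h2]; split.
- move=> i; case: (ltnP i (size T)) => lt; last by rewrite nth_default.
  by apply: (allP h1); exact: mem_nth.
- move=> i j ltj; case: (ltnP i.+1 (size T)) => lt; last by rewrite nth_default in ltj.
  have /allP := h2 => /(_ i); rewrite mem_iota; case: (size T) lt => // r lt.
  by move=> /(_ lt)/allP/(_ j); rewrite mem_iota; exact.
- by apply/allP => r /(nthP [::])[i _ <-].
apply/allP => i _; apply/allP => j; rewrite mem_iota; exact: h2.
Qed.

Lemma sorted_split N (s : seq nat) : sorted leq s -> all (gtn N.+1) s ->
  s = [seq x <- s | x < N] ++ nseq (size s - size [seq x <- s | x < N]) N.
Proof.
elim: s => //= x s IH ps /andP[xN sN].
have {}IH := IH (path_sorted ps) sN.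
case: ltnP => [_|leN] /=; first by rewrite subSS -IH.
have Ex : x = N by lia.
have s_eq : all (pred1 N) s.
  apply/allP => y ys /=; have := allP sN y ys => /=.
  by have := allP (order_path_min leq_trans ps) y ys => /=; lia.
have -> : [seq x <- s | x < N] = [::].
  rewrite (eq_in_filter (a2 := pred0)) ?filter_pred0 // => y ys /=.
  by have /eqP -> := allP s_eq y ys; rewrite ltnn.
by rewrite Ex /=; congr (_ :: _); apply/all_pred1P.
Qed.

Lemma size_nth (T : seq (seq nat)) i : size (nth [::] T i) = nth 0 (map size T) i.
Proof.
case: (ltnP i (size T)) => lt; first by rewrite (nth_map [::]).
by rewrite !nth_default ?size_map.
Qed.

Lemma all_nth (p : pred nat) (T : seq (seq nat)) i : all (all p) T -> all p (nth [::] T i).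
Proof.
move=> TN; case: (ltnP i (size T)) => lt; last by rewrite nth_default.
by apply: (allP TN); exact: mem_nth.
Qed.

Definition restr N (T : seq (seq nat)) : seq (seq nat) :=
  [seq [seq x <- r | x < N] | r <- T].

Lemma nth_restr N T i : nth [::] (restr N T) i = [seq x <- nth [::] T i | x < N].
Proof.
case: (ltnP i (size T)) => lt; first by rewrite (nth_map [::]).
by rewrite !nth_default ?size_map.
Qed.

Lemma content_restr N T : all (all (gtn N.+1)) T ->
  content N.+1 T = rcons (content N (restr N T)) (count_mem N (flatten T)) /\
  sumn (map size T) = sumn (map size (restr N T)) + count_mem N (flatten T).
Proof.
move=> TN; have fE : flatten (restr N T) = [seq x <- flatten T | x < N].
  by rewrite filter_flatten.
split.
  rewrite /content -addn1 iotaD map_cat cats1 add0n; congr (rcons _ _).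
  apply/eq_in_map => i; rewrite mem_iota fE count_filter => lt.
  by apply: eq_count => x /=; case: eqP => // ->; rewrite lt.
rewrite -[map size T]/(shape T) -[map size _]/(shape (restr N T)) -!size_flatten fE.
rewrite size_filter -(count_predC (fun x => x < N)); congr (_ + _).
apply: eq_in_count => x /flattenP[r /(allP TN) rN xr] /=.
by have := allP rN x xr => /=; lia.
Qed.

Lemma count_leq_inj (T U : eqType) (s : seq T) (t : seq U) (p : pred T) (q : pred U)
    (f : T -> U) (g : U -> T) : uniq s ->
  (forall x, x \in s -> p x -> [/\ f x \in t, q (f x) & g (f x) = x]) ->
  count p s <= count q t.
Proof.
move=> us h; rewrite -!size_filter -(size_map f); apply: uniq_leq_size.
  rewrite map_inj_in_uniq ?filter_uniq // => x y.
  rewrite !mem_filter => /andP[px xs] /andP[py ys] E.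
  by have [_ _ <-] := h x xs px; have [_ _ <-] := h y ys py; rewrite E.
move=> y /mapP[x]; rewrite mem_filter => /andP[px xs] ->.
by have [ft qf _] := h x xs px; rewrite mem_filter qf.
Qed.

Lemma count_bij (T U : eqType) (s : seq T) (t : seq U) (p : pred T) (q : pred U)
    (f : T -> U) (g : U -> T) : uniq s -> uniq t ->
  (forall x, x \in s -> p x -> [/\ f x \in t, q (f x) & g (f x) = x]) ->
  (forall y, y \in t -> q y -> [/\ g y \in s, p (g y) & f (g y) = y]) ->
  count p s = count q t.
Proof.
move=> us ut h1 h2; apply/eqP; rewrite eqn_leq (count_leq_inj us h1).
exact: count_leq_inj ut h2.
Qed.

(** * Branching of tableaux by their largest letter *)

Section Kostka.
Variable M : nat.
Local Notation P := (ptn M).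

Definition toptn (s : seq nat) : P := mkptn M (nth 0 s).

(** Trailing zeros are allowed: deleting the largest letter may empty a row, while [restr] keeps the
    number of rows. *)
Definition pshape (s : seq nat) : Prop :=
  [/\ forall i, nth 0 s i.+1 <= nth 0 s i, nth 0 s 0 <= M & size s <= M].

Lemma toptnE s i : pshape s -> toptn s i = nth 0 s i.
Proof.
by case=> h1 h2 h3; apply: mkptnE; split=> //; rewrite nth_default.
Qed.

Lemma psz_toptn s : pshape s -> psz (toptn s) = sumn s.
Proof.
move=> hs; have [_ _ szM] := hs; rewrite sumnE (big_nth 0) big_mkord.
rewrite /psz (eq_bigr (fun i : 'I_M => nth 0 s i)) => [|i _]; last by rewrite toptnE.
apply/eqP; rewrite eqn_leq; apply/andP; split.
  by apply: (@sum_ord_vanish (size s) M (nth 0 s)) => i; exact: nth_default.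
exact: (@sum_ord_leq (size s) M (nth 0 s)).
Qed.

Definition exten N (sh : seq nat) (T : seq (seq nat)) : seq (seq nat) :=
  mkseq (fun i => nth [::] T i ++ nseq (nth 0 sh i - size (nth [::] T i)) N) (size sh).

Lemma mkseq_ptn (mu : P) r : r <= M -> (forall i, r <= i -> mu i = 0) ->
  [/\ forall i, nth 0 (mkseq mu r) i = mu i, pshape (mkseq mu r) & toptn (mkseq mu r) = mu].
Proof.
move=> rM mu0; have E i : nth 0 (mkseq mu r) i = mu i.
  by case: (ltnP i r) => le; [rewrite nth_mkseq | rewrite nth_default ?size_mkseq ?mu0].
have ps : pshape (mkseq mu r).
  by split=> [i||]; rewrite ?E ?prowS ?prow_max ?size_mkseq.
by split=> //; apply: ptnP => i _; rewrite toptnE.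
Qed.

(** The shape [mu] of the smaller letters fixes the places of the letter [N], so [restr] and [exten]
    are inverse; column strictness for these places is the horizontal strip condition. *)
Lemma kostka_fiber N sh m k (mu : P) : pshape sh ->
  hs (toptn sh) mu -> psz (toptn sh) = psz mu + k ->
  count (fun T => (is_ssyt T && (content N.+1 T == rcons m k))
                  && (map size (restr N T) == mkseq mu (size sh))) (fillings sh N.+1)
  = kostka N (mkseq mu (size sh)) m.
Proof.
move=> psh /hsP hmu Ek; have [_ _ szM] := psh.
have {}hmu i : nth 0 sh i.+1 <= mu i <= nth 0 sh i by have := hmu i; rewrite !toptnE.
have mu0 i : size sh <= i -> mu i = 0.
  by move=> le; have := hmu i; rewrite [nth 0 sh i]nth_default //; lia.
have [muE muS muK] := mkseq_ptn szM mu0.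
apply: (@count_bij _ _ _ _ _ _ (restr N) (exten N sh));
  rewrite ?fillings_uniq // => T; rewrite mem_fillings => /andP[/eqP szT TN].
  move=> /andP[/andP[/ssytP[h1 h2] /eqP cT] /eqP szR].
  have szTi i : size (nth [::] T i) = nth 0 sh i by rewrite size_nth szT.
  have szRi i : size (nth [::] (restr N T) i) = mu i by rewrite size_nth szR muE.
  have split_i i := sorted_split (h1 i) (all_nth i TN).
  have szF i : size [seq x <- nth [::] T i | x < N] = mu i by rewrite -nth_restr szRi.
  have nthF i j : j < mu i ->
      nth 0 [seq x <- nth [::] T i | x < N] j = nth 0 (nth [::] T i) j.
    by move=> lt; rewrite [in RHS]split_i nth_cat szF lt.
  split.
  - rewrite mem_fillings szR eqxx /=; apply/allP => _ /mapP[r _ ->]; exact: filter_all.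
  - apply/andP; split; last first.
      have [E _] := content_restr TN; move: cT; rewrite E => /rcons_inj[-> _].
      exact: eqxx.
    apply/ssytP; split=> [i|i j].
      by rewrite nth_restr; apply: sorted_filter => //; exact: leq_trans.
    rewrite !nth_restr szF => ltj; have := hmu i; have := hmu i.+1 => lt1 lt2.
    rewrite !nthF //; last by lia.
    by apply: h2; rewrite szTi; lia.
  apply: (@eq_from_nth _ [::]) => [|i].
    by rewrite size_mkseq -szT size_map.
  rewrite size_mkseq => lt; rewrite nth_mkseq // nth_restr -szTi; exact/esym/split_i.
move=> /andP[/ssytP[h1 h2] /eqP cT].
have szTi i : size (nth [::] T i) = mu i by rewrite size_nth szT muE.
have extE i : nth [::] (exten N sh T) i = nth [::] T i ++ nseq (nth 0 sh i - mu i) N.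
  case: (ltnP i (size sh)) => lt; first by rewrite nth_mkseq // szTi.
  rewrite [LHS]nth_default ?size_mkseq // [nth 0 sh i]nth_default // sub0n cats0.
  by apply/esym/size0nil; rewrite szTi mu0.
have extN : all (all (gtn N.+1)) (exten N sh T).
  apply/allP => _ /(nthP [::])[i _ <-]; rewrite extE all_cat all_nseq /= ltnSn orbT andbT.
  by apply: sub_all (all_nth i TN) => x /=; lia.
have szE : map size (exten N sh T) = sh.
  apply: (@eq_from_nth _ 0); first by rewrite size_map size_mkseq.
  move=> i; rewrite size_map => lt; rewrite (nth_map [::]) // extE size_cat size_nseq szTi.
  by have := hmu i; lia.
have restrE : restr N (exten N sh T) = T.
  apply: (@eq_from_nth _ [::]).
    by rewrite !size_map size_iota -(size_map size T) szT size_mkseq.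
  move=> i _; rewrite nth_restr extE filter_cat [X in _ ++ X](_ : _ = [::]) ?cats0.
    by apply/all_filterP; exact: all_nth.
  by elim: (_ - _) => //= r IH; rewrite ltnn.
split=> //; first by rewrite mem_fillings szE eqxx.
rewrite restrE szT eqxx andbT; apply/andP; split; last first.
  have [-> Esz] := content_restr extN; move: Esz; rewrite szE restrE cT szT.
  by rewrite -psz_toptn // Ek -(psz_toptn muS) muK => /addnI ->.
apply/ssytP; split=> [i|i j].
  rewrite extE (sorted_pairwise leq_trans) pairwise_cat -(sorted_pairwise leq_trans) h1 /=.
  rewrite -(sorted_pairwise leq_trans); apply/andP; split; last first.
    by elim: (_ - _) => // -[|r] //= IH; rewrite leqnn.
  apply/allrelP => x y xT; rewrite mem_nseq => /andP[_ /eqP->].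
  by have := allP (all_nth i TN) x xT => /=; lia.
rewrite !extE size_cat size_nseq !nth_cat !szTi => ltj.
have := hmu i; have := hmu i.+1 => lt1 lt2.
rewrite ifT; last by lia.
case: (ltnP j (mu i.+1)) => lt; first by apply: h2; rewrite szTi.
rewrite nth_nseq ifT; last by lia.
by apply: (allP (all_nth i TN)); apply: mem_nth; rewrite szTi; lia.
Qed.

Lemma interlace_restr N sh m k T : pshape sh -> T \in fillings sh N.+1 -> is_ssyt T ->
  content N.+1 T = rcons m k ->
  let mu := toptn (map size (restr N T)) in
  [/\ mkseq mu (size sh) = map size (restr N T), hs (toptn sh) mu &
      psz (toptn sh) = psz mu + k].
Proof.
move=> psh; have [shd sh0 szM] := psh.
rewrite mem_fillings => /andP[/eqP szT TN] /ssytP[h1 h2] cT mu.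
have szTi i : size (nth [::] T i) = nth 0 sh i.
  by rewrite size_nth szT.
have TNi i : all (gtn N.+1) (nth [::] T i) := all_nth i TN.
set s := map size (restr N T) in mu *.
have szs : size s = size sh by rewrite /s /restr !size_map -szT size_map.
have sE i : nth 0 s i = size [seq x <- nth [::] T i | x < N] by rewrite -size_nth nth_restr.
(* If row [i] had fewer than [nth 0 sh i.+1] letters below [N], some [N] would stand above an entry
   of the next row, which cannot exceed [N]. *)
have inter i : nth 0 sh i.+1 <= nth 0 s i <= nth 0 sh i.
  rewrite sE size_filter -[X in _ <= _ <= X]szTi count_size andbT leqNgt -size_filter.
  have Ei := sorted_split (h1 i) (TNi i); move: Ei; set f := [seq x <- _ | _] => Ei.
  apply/negP => lt; have := h2 i (size f); rewrite szTi => /(_ lt).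
  have -> : nth 0 (nth [::] T i) (size f) = N.
    rewrite Ei nth_cat ltnn subnn nth_nseq szTi ifT //.
    by have := shd i; lia.
  have : nth 0 (nth [::] T i.+1) (size f) < N.+1.
    by apply: (allP (TNi i.+1)); apply: mem_nth; rewrite szTi.
  by rewrite ltnS leqNgt => /negP.
have ps : pshape s.
  split=> [i||]; last by rewrite szs.
    by have := inter i; have := inter i.+1; lia.
  by have := inter 0; lia.
split.
- apply: (@eq_from_nth _ 0); first by rewrite size_mkseq.
  by move=> i; rewrite size_mkseq => lt; rewrite nth_mkseq // toptnE.
- by apply/hsP => i; rewrite !toptnE.
rewrite !psz_toptn //; have [E1 E2] := content_restr TN.
by move: cT E2; rewrite E1 => /rcons_inj[_ ->]; rewrite szT.
Qed.

Lemma kostka_rec N sh m k : pshape sh ->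
  kostka N.+1 sh (rcons m k) =
  \sum_(mu : P | hs (toptn sh) mu && (psz (toptn sh) == psz mu + k))
     kostka N (mkseq mu (size sh)) m.
Proof.
move=> psh; rewrite {1}/kostka -sum1_count.
rewrite big_seq_cond (partition_big (fun T => toptn (map size (restr N T)))
   (fun mu => hs (toptn sh) mu && (psz (toptn sh) == psz mu + k))) /=; last first.
  move=> T /and3P[T_in sT /eqP cT].
  by have [_ -> ->] := interlace_restr psh T_in sT cT; rewrite eqxx.
apply: eq_bigr => mu /andP[hmu /eqP Ek].
rewrite -(kostka_fiber _ _ psh hmu Ek) -sum1_count [RHS]big_seq_cond.
apply: eq_bigl => T; rewrite -andbA -andbA; case T_in: (T \in _) => //=.
case sT: (is_ssyt T) => //=; case: eqP => //= cT.
have [E _ _] := interlace_restr psh T_in sT cT.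
have [_ _ szM] := psh.
have mu0 i : size sh <= i -> mu i = 0.
  by move=> le; have /hsP/(_ i) := hmu; rewrite !toptnE // [nth 0 sh i]nth_default //; lia.
have [_ _ muK] := mkseq_ptn szM mu0.
by apply/eqP/eqP => [<-|->].
Qed.

Lemma kostka_kos N sh m : pshape sh -> size m = N ->
  Posz (kostka N sh m) = kos (toptn sh) m.
Proof.
(* [kos] peels the first exponent, whereas tableaux lose their largest letter, whose multiplicity
   comes last; symmetry allows reversing the content. *)
move=> psh szm; rewrite -(@perm_kos M _ (rev m)) ?perm_rev //.
elim: N sh m psh szm => [|N IH] sh m psh szm.
  rewrite (size0nil szm) /kos /= /basis; case: eqP => [E|ne] /=.
    have sh0 i : nth 0 sh i = 0 by rewrite -(toptnE i psh) E ptn0E.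
    have -> : sh = nseq (size sh) 0.
      apply: (@eq_from_nth _ 0); first by rewrite size_nseq.
      by move=> i _; rewrite sh0 nth_nseq if_same.
    have fE r : fillings (nseq r 0) 0 = [:: nseq r [::]] by elim: r => //= r ->.
    rewrite /kostka fE /= addn0 andbT (_ : is_ssyt _ = true) //.
    by apply/ssytP; split=> [i|i j]; rewrite !nth_nseq !if_same.
  rewrite /kostka (_ : count _ _ = 0) //; apply/eqP; rewrite -leqn0 leqNgt -has_count.
  apply/negP => /hasP[T]; rewrite mem_fillings => /andP[/eqP szT TN] _; apply: ne.
  apply: ptnP => i _; rewrite toptnE // ptn0E -szT.
  case: (ltnP i (size T)) => lt; last by rewrite nth_default ?size_map.
  rewrite (nth_map [::]) //; have := allP TN _ (mem_nth [::] lt).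
  by case: (nth [::] T i).
case/lastP: m szm => // m k; rewrite size_rcons => -[szm].
rewrite kostka_rec // rev_rcons kos_cons (big_morph Posz PoszD (erefl _)).
apply: eq_bigr => mu /andP[/hsP h _]; have [_ _ szM] := psh.
have mu0 i : size sh <= i -> mu i = 0.
  by move=> le; have := h i; rewrite !toptnE // [nth 0 sh i]nth_default //; lia.
by have [_ muS muK] := mkseq_ptn szM mu0; rewrite IH // muK.
Qed.

End Kostka.

(** * The intersection number *)

Lemma mem_comps f n t : n <= f ->
  (t \in comps_f f n) = all (fun x => 0 < x) t && (sumn t == n).
Proof.
elim: f n t => [|f IH] n t le_nf /=.
  have -> : n = 0 by lia.
  by rewrite inE; case: t => [|[|x] t] //=; rewrite andbF.
case: eqP => [->|/eqP n0].
  by rewrite inE; case: t => [|[|x] t] //=; rewrite andbF.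
apply/allpairsPdep/idP => [[i [s []]]|].
  rewrite mem_iota => le_i; rewrite IH; last by lia.
  by move=> /andP[sp /eqP Es] ->; rewrite /= sp Es; apply/andP; split; [|apply/eqP]; lia.
case: t => [|x t] /=; first by rewrite eq_sym (negPf n0).
move=> /andP[/andP[x0 tp] /eqP Et]; exists x, t; split=> //.
  by rewrite mem_iota; lia.
by rewrite IH; [rewrite tp; apply/eqP|]; lia.
Qed.

Lemma comps_uniq f n : uniq (comps_f f n).
Proof.
elim: f n => [|f IH] n /=; case: eqP => // _.
apply: allpairs_uniq_dep => [|i _|]; first exact: iota_uniq.
  exact: IH.
by move=> [i s] [j t] _ _ /= [-> ->].
Qed.

Lemma mem_partitions_of k t : (t \in partitions_of k) = is_partition t && (sumn t == k).
Proof.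
rewrite mem_filter mem_comps // /is_partition.
by case: sorted => //=; case: all.
Qed.

Lemma partitions_of_uniq k : uniq (partitions_of k).
Proof. exact/filter_uniq/comps_uniq. Qed.

Lemma partition_nth s : is_partition s ->
  (forall i, nth 0 s i.+1 <= nth 0 s i) /\ (forall i, i < size s -> 0 < nth 0 s i).
Proof.
move=> /andP[/(sortedP 0) ss /(all_nthP 0) sp]; split=> // i.
case: (ltnP i.+1 (size s)) => lt; first exact: ss.
by rewrite nth_default.
Qed.

Lemma nth_partition s : (forall i, nth 0 s i.+1 <= nth 0 s i) ->
  (forall i, i < size s -> 0 < nth 0 s i) -> is_partition s.
Proof.
by move=> h1 h2; apply/andP; split; [apply/(sortedP 0) => i _; exact: h1|apply/(all_nthP 0)].
Qed.

Lemma nth_box a b i : nth 0 (box a b) i = if i < a then b else 0.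
Proof.
rewrite /box; case: eqP => [->|_]; first by rewrite nth_nil if_same.
by rewrite nth_nseq.
Qed.

Lemma box_partition a b : is_partition (box a b).
Proof.
apply: nth_partition => i; rewrite !nth_box; first by case: ifP; case: ifP; lia.
by rewrite /box; case: eqP => // b0; rewrite size_nseq => ->; lia.
Qed.

Lemma subp_box s a b : is_partition s ->
  subp s (box a b) = (size s <= a) && (nth 0 s 0 <= b).
Proof.
move=> /partition_nth[sd sp]; apply/allP/andP => [h|[sza s0] i].
  have {}h i : i < size s -> nth 0 s i <= if i < a then b else 0.
    by move=> lt; rewrite -nth_box; apply: h; rewrite mem_iota.
  split; last first.
    case: s sd sp h => // x s _ _ /(_ 0 isT) /=; case: ifP => //; lia.
  rewrite leqNgt; apply/negP => lt; have := h a lt; rewrite ltnn.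
  by have := sp a lt; lia.
rewrite mem_iota nth_box => lt; rewrite ifT; last by lia.
by apply: leq_trans s0; apply: fun_dec.
Qed.

Section Delta.
Variable M : nat.
Local Notation P := (ptn M).
Implicit Types l : P.

(** [conj l 0] is the number of nonzero rows, so no zero part is listed. *)
Definition ofptn l : seq nat := mkseq l (conj l 0).

Lemma nth_ofptn l i : nth 0 (ofptn l) i = l i.
Proof.
case: (ltnP i (conj l 0)) => lt; first by rewrite nth_mkseq.
rewrite nth_default ?size_mkseq //; move: lt; rewrite leqNgt conjP; lia.
Qed.

Lemma ofptn_partition l : is_partition (ofptn l).
Proof.
apply: nth_partition => i; rewrite !nth_ofptn ?prowS //.
by rewrite size_mkseq conjP.
Qed.

Lemma pshape_ofptn l : pshape M (ofptn l).
Proof.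
split=> [i||]; rewrite ?nth_ofptn ?prowS ?prow_max // size_mkseq; exact: prow_max.
Qed.

Lemma ofptnK l : toptn M (ofptn l) = l.
Proof. by apply: ptnP => i _; rewrite toptnE ?nth_ofptn //; exact: pshape_ofptn. Qed.

Lemma toptnK s : is_partition s -> pshape M s -> ofptn (toptn M s) = s.
Proof.
move=> /partition_nth[_ sp] ps.
have sz : conj (toptn M s) 0 = size s.
  apply: ltn_ext => i; rewrite conjP toptnE //.
  by case: (ltnP i (size s)) => lt; [rewrite sp | rewrite nth_default].
apply: (@eq_from_nth _ 0); first by rewrite size_mkseq.
by move=> i _; rewrite nth_ofptn toptnE.
Qed.

Lemma pshape_partition_of s : is_partition s -> sumn s <= M -> pshape M s.
Proof.
move=> /partition_nth[sd sp] leM; split=> //.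
  apply: leq_trans leM; case: s {sd sp} => //= x s; exact: leq_addr.
apply: leq_trans leM; rewrite sumnE (big_nth 0) big_mkord -{1}(card_ord (size s)).
by rewrite -sum1_card; apply: leq_sum => i _; exact: sp.
Qed.

Lemma sum_partitions_of (R : nmodType) k (F : seq nat -> R) : k <= M ->
  (\sum_(nu <- partitions_of k) F nu = \sum_(l | psz l == k) F (ofptn l))%R.
Proof.
move=> leM; rewrite -[RHS]big_filter -[RHS](big_map ofptn xpredT F); apply: perm_big.
apply: uniq_perm; first exact: partitions_of_uniq.
  rewrite map_inj_uniq ?filter_uniq ?index_enum_uniq //; exact: can_inj ofptnK.
move=> s; rewrite mem_partitions_of; apply/andP/mapP => [[sp /eqP Es]|[l]].
  have ps : pshape M s by apply: pshape_partition_of; rewrite ?Es.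
  exists (toptn M s); last by rewrite toptnK.
  by rewrite mem_filter mem_index_enum psz_toptn ?Es ?eqxx.
rewrite mem_filter => /andP[/eqP El _] ->; split; first exact: ofptn_partition.
by rewrite -(@psz_toptn M) ?ofptnK ?El //; exact: pshape_ofptn.
Qed.

Lemma pshape_box a b : a <= M -> b <= M -> pshape M (box a b).
Proof.
move=> leaM lebM; split=> [j||]; rewrite ?nth_box; first by case: ifP; case: ifP; lia.
  by case: ifP.
by rewrite /box; case: eqP; rewrite ?size_nseq.
Qed.

Lemma toptn_box a b : a <= M -> b <= M -> toptn M (box a b) = boxp M a b.
Proof.
move=> leaM lebM; apply: ptnP => i _.
by rewrite boxpE // toptnE ?nth_box //; exact: pshape_box.
Qed.

Lemma polyprod_schur N (ls : seq (seq nat)) (m : seq nat) :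
  (forall s, s \in ls -> pshape M s) -> size m = N ->
  polyprod [seq schur N s | s <- ls] m = polyprod [seq kos (toptn M s) | s <- ls] m.
Proof.
elim: ls m => [|s ls IH] m psh szm //=; apply: eq_polymul => t szt _.
  by rewrite /schur (@kostka_kos M) ?szt //; apply: psh; rewrite mem_head.
by apply: IH; rewrite ?szt // => s' s'ls; apply: psh; rewrite in_cons s'ls orbT.
Qed.

(** As [delta] is defined by choice, an expansion must exist and its coefficient at the rectangle
    must be unique. The vector [lrc] provides the former, [kos_free] in [D] variables the latter. *)
Lemma delta_lrc a b (ls : seq (seq nat)) : a <= M -> b <= M -> a * b <= M ->
  (forall s, s \in ls -> pshape M s) -> sumn (map psize ls) = a * b ->
  delta a b ls = lrc [seq toptn M s | s <- ls] (boxp M a b).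
Proof.
move=> leaM lebM leM psh Ek; set v := lrc _; set D := a * b in leM Ek.
have ED : \sum_(l <- [seq toptn M s | s <- ls]) psz l = D.
  rewrite big_map -Ek sumnE big_map; apply: eq_big_seq => s /psh; exact: psz_toptn.
have expand m : size m = D ->
    polyprod [seq schur D s | s <- ls] m = (\sum_(l | psz l == D) v l * kos l m)%R.
  move=> szm; rewrite polyprod_schur // (map_comp (@kos M) (toptn M)).
  have [Em|nem] := eqVneq (sumn m) D.
    rewrite polyprod_lrc ?Em // /spoly [RHS]big_mkcond /=; apply: eq_bigr => l _.
    case: eqP => // ne; have [->|/kos_psz] := eqVneq (kos l m) 0%R; first by rewrite mulr0.
    by rewrite Em.
  have [->|/polyprod_homog] := eqVneq (polyprod [seq kos l | l <- [seq toptn M s | s <- ls]] m) 0%R.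
    rewrite big1 // => l /eqP El; have [->|/kos_psz E] := eqVneq (kos l m) 0%R.
      by rewrite mulr0.
    by case/eqP: nem; rewrite -E.
  by rewrite ED => /eqP; rewrite (negPf nem).
have sumE (cf : seq nat -> int) m : size m = D ->
    (\sum_(nu <- partitions_of D) cf nu * Posz (kostka D nu m)
     = \sum_(l | psz l == D) cf (ofptn l) * kos l m)%R.
  move=> szm; rewrite sum_partitions_of //; apply: eq_bigr => l _.
  by rewrite (@kostka_kos M) ?ofptnK //; exact: pshape_ofptn.
have boxE := toptn_box leaM lebM; have psb := pshape_box leaM lebM.
rewrite /delta Ek -/D.
have ex : exists x, exists cf, schur_expansion D D (polyprod [seq schur D s | s <- ls]) cf
     /\ cf (box a b) = x.
  exists (v (boxp M a b)), (fun nu => v (toptn M nu)); rewrite boxE; split=> // m szm.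
  by rewrite expand // sumE //; apply: eq_bigr => l _; rewrite ofptnK.
have [cf [cfE <-]] := epsilon_spec (inhabits 0%R) _ ex.
(* The expansion constrains [cf] only on partitions of size [D], so the difference is cut down to
   these. *)
pose u l := (if psz l == D then cf (ofptn l) - v l else 0)%R.
have Dbox := psz_boxp leaM lebM; rewrite -/D in Dbox.
have := @kos_free M D D u _ (boxp M a b).
rewrite /u Dbox eqxx -boxE toptnK ?box_partition // => u0.
apply/eqP; rewrite -subr_eq0; apply/eqP; apply: u0 => //.
  move=> s szs _; rewrite /spoly.
  transitivity (\sum_(l | psz l == D) cf (ofptn l) * kos l s
                - \sum_(l | psz l == D) v l * kos l s : int)%R.
    rewrite -sumrB [RHS]big_mkcond; apply: eq_bigr => l _ /=.
    by case: ifP => _; rewrite ?mul0r // mulrBl.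
  by rewrite -expand // -sumE // -cfE // subrr.
(* The rectangle has at most [D = a * b] rows: [D < a] is possible only for [b = 0], when it is
   empty. *)
rewrite toptnE // nth_box; case: ltnP => // lt.
have := lt; rewrite /D; case: (b) => // b'; rewrite mulnS; lia.
Qed.

End Delta.

(** * Composed conditions *)

Lemma nth_padd m n i : nth 0 (padd m n) i = nth 0 m i + nth 0 n i.
Proof.
rewrite /padd; case: (ltnP i (maxn (size m) (size n))) => lt.
  by rewrite (nth_map 0) ?size_iota // nth_iota.
by rewrite !nth_default ?size_map ?size_iota //; lia.
Qed.

Lemma pjoin_cat m n : is_partition m -> is_partition n ->
  (forall i, i < size m -> nth 0 n 0 <= nth 0 m i) ->
  pjoin m n = m ++ n /\ is_partition (m ++ n).
Proof.
move=> pm pn le; have [md mp] := partition_nth pm; have [nd np] := partition_nth pn.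
have pmn : is_partition (m ++ n).
  apply: nth_partition => i.
    rewrite !nth_cat; case: (ltnP i (size m)) => lt1; case: (ltnP i.+1 (size m)) => lt2 //.
    - by rewrite (_ : i.+1 - size m = 0) ?le //; lia.
    - by lia.
    by rewrite subSn.
  rewrite size_cat nth_cat; case: (ltnP i (size m)) => [lt _|le' lt]; first exact: mp.
  by apply: np; lia.
split=> //; apply: (sorted_sort (leT := geq)); last by case/andP: pmn.
by move=> x y z /=; lia.
Qed.

(** Since [e] is positive, all [x] rows of the rectangle are listed parts; each is at least [e],
    hence at least [nth 0 l 0], so sorting changes nothing. *)
Lemma condition_above x e m l : 0 < e -> is_partition m -> is_partition l ->
  size m <= x -> nth 0 l 0 <= e ->
  let s := pjoin (padd (box x e) m) l in
  [/\ forall i, nth 0 s i = if i < x then e + nth 0 m i else nth 0 l (i - x),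
      is_partition s & size s = x + size l].
Proof.
move=> e0 pm pl szm l0 s; have [md _] := partition_nth pm.
have szp : size (padd (box x e) m) = x.
  by rewrite /padd size_map size_iota /box gtn_eqF // size_nseq; apply/maxn_idPl.
have nthp i : nth 0 (padd (box x e) m) i = if i < x then e + nth 0 m i else 0.
  rewrite nth_padd nth_box; case: ltnP => // le; rewrite nth_default //; lia.
have pp : is_partition (padd (box x e) m).
  apply: nth_partition => i; rewrite ?szp !nthp.
    by have := md i; case: ifP; case: ifP; lia.
  by move=> ->; lia.
have [|Es ps] := pjoin_cat pp pl.
  by move=> i; rewrite szp nthp => ->; lia.
rewrite /s Es; split=> //; last by rewrite size_cat szp.
by move=> i; rewrite nth_cat szp nthp; case: ltnP.
Qed.

Lemma condition_left x e m l : is_partition m -> is_partition l ->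
  size m <= x -> nth 0 l 0 <= e ->
  let s := padd (pjoin (box x e) l) m in
  [/\ forall i, nth 0 s i = if i < x then e + nth 0 m i else nth 0 l (i - x),
      is_partition s & size s <= x + size l].
Proof.
move=> pm pl szm l0 s; have [md mp] := partition_nth pm; have [ld lp] := partition_nth pl.
have [|Es ps] := pjoin_cat (box_partition x e) pl.
  by rewrite /box; case: eqP => [//|_] i; rewrite size_nseq => lt; rewrite nth_nseq lt.
have szb : size (box x e) <= x by rewrite /box; case: eqP; rewrite ?size_nseq.
have nthc i : nth 0 (box x e ++ l) i = if i < x then e else nth 0 l (i - x).
  rewrite nth_cat nth_box /box; case: eqP => [e0|_]; last by rewrite size_nseq; case: ltnP.
  (* For [e = 0] the box is the empty list instead of [x] zero rows, and the formula survives
     because [nth 0 l 0 <= 0] makes [l] empty. *)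
  have l_nil : l = [::] by case: (l) l0 lp => // y t; rewrite e0 => /= le /(_ 0 isT) /=; lia.
  by rewrite l_nil e0 !nth_nil !if_same.
have nths i : nth 0 s i = if i < x then e + nth 0 m i else nth 0 l (i - x).
  rewrite /s Es nth_padd nthc; case: ltnP => // le.
  by rewrite [nth 0 m i]nth_default ?addn0 //; lia.
split=> //; last by rewrite /s Es /padd size_map size_iota size_cat; lia.
apply: nth_partition => i.
  rewrite !nths; case: (ltnP i x) => lt1; case: (ltnP i.+1 x) => lt2.
  - by have := md i; lia.
  - by rewrite (_ : i.+1 - x = 0); lia.
  - by lia.
  by rewrite subSn.
rewrite /s Es nth_padd /padd size_map size_iota => lt.
have [_ pos] := partition_nth ps.
case: (ltnP i (size (box x e ++ l))) => lt'; first by have := pos i lt'; lia.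
by have := mp i; lia.
Qed.

Section ToCorner.
Variable M : nat.

Lemma toptn_corner x e m l s : pshape M m -> pshape M l -> pshape M s ->
  x + size l <= M -> e + nth 0 m 0 <= M -> size m <= x -> nth 0 l 0 <= e ->
  (forall i, nth 0 s i = if i < x then e + nth 0 m i else nth 0 l (i - x)) ->
  toptn M s = corner x e (toptn M m) (toptn M l)
  /\ sumn s = sumn m + x * e + sumn l.
Proof.
move=> pm pl ps lex lee szm l0 sE.
have h1 : x <= M by lia.
have h2 : e + toptn M m 0 <= M by rewrite toptnE.
have h3 : toptn M l 0 <= e by rewrite toptnE.
have h4 : toptn M l (M - x) = 0 by rewrite toptnE // nth_default //; lia.
have h5 : toptn M m x = 0 by rewrite toptnE // nth_default.
have E : toptn M s = corner x e (toptn M m) (toptn M l).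
  by apply: ptnP => i _; rewrite cornerE // !toptnE.
by split=> //; rewrite -!(@psz_toptn M) // E psz_corner.
Qed.

End ToCorner.

Lemma map_zip3 (S T U : Type) (s : seq S) (t : seq T) (u : seq U) :
  size s = size t -> size u = size t ->
  [/\ [seq x.1.1 | x <- zip (zip s t) u] = s, [seq x.1.2 | x <- zip (zip s t) u] = t &
      [seq x.2 | x <- zip (zip s t) u] = u].
Proof.
move=> st ut; have szz : size (zip s t) = size u by rewrite size_zip st minnn.
rewrite (map_comp fst fst) (map_comp snd fst) -/(unzip1 (zip _ u)) -/(unzip2 (zip _ u)).
rewrite unzip1_zip ?szz // unzip2_zip ?szz //.
by rewrite -/(unzip1 _) -/(unzip2 _) unzip1_zip ?unzip2_zip ?st.
Qed.

Lemma zip3P (S T U : eqType) (x0 : S) (y0 : T) (s : seq S) (t : seq T) (u : seq U) x :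
  size s = size t -> size u = size t -> x \in zip (zip s t) u ->
  [/\ x.1.2 \in t, x.2 \in u & exists2 i, i < size t & x.1 = (nth x0 s i, nth y0 t i)].
Proof.
move=> st ut xz; have [_ E2 E3] := map_zip3 st ut; split.
- by rewrite -E2; apply/mapP; exists x.
- by rewrite -E3; apply/mapP; exists x.
have : x.1 \in unzip1 (zip (zip s t) u) by apply/mapP; exists x.
rewrite unzip1_zip ?size_zip ?st ?ut ?minnn // => /(nthP (x0, y0))[i].
by rewrite size_zip st minnn => lt <-; exists i; rewrite // nth_zip.
Qed.

Theorem theorem2p9 (a b c d : nat) (lam mu nu : seq (seq nat)) (as_ bs : seq nat)
  (alpha beta gamma : seq (seq nat)) :
  schubert_problem a b lam ->
  composable a b lam mu nu as_ bs ->
  0 < c -> 0 < d ->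
  size alpha = size mu -> size beta = size nu ->
  schubert_problem c d (alpha ++ beta ++ gamma) ->
  schubert_problem (a + c) (b + d) (compose c d as_ bs mu nu alpha beta gamma) /\
  delta (a + c) (b + d) (compose c d as_ bs mu nu alpha beta gamma)
    = (delta a b lam * delta c d (alpha ++ beta ++ gamma))%R.
Proof.
move=> /andP[/allP lamP /eqP lam_sum] [perm_lam [sza [szb [suma [sumb [lenmu fstnu]]]]]].
move=> c0 d0 szal szbe /andP[/allP rhoP /eqP rho_sum].
(* The degree of the composed problem; the two smaller problems have lower degree and all rectangles
   fit in the square. *)
set M := (a + c) * (b + d).
have leA : a + c <= M by rewrite leq_pmulr //; lia.
have leB : b + d <= M by rewrite leq_pmull //; lia.
have leM : (a + c) * (b + d) <= M by [].
pose cond x y s := [/\ is_partition s, size s <= x & nth 0 s 0 <= y].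
have condP x y s : is_partition s && subp s (box x y) -> cond x y s.
  by move=> /andP[ps]; rewrite subp_box // => /andP[? ?].
have cond_psh x y s : x <= M -> y <= M -> cond x y s -> pshape M s.
  move=> xM yM [ps szs s0]; have [sd _] := partition_nth ps.
  by split=> //; lia.
have muP s : s \in mu -> cond a b s.
  by move=> h; apply/condP/lamP; rewrite (perm_mem perm_lam) mem_cat h.
have nuP s : s \in nu -> cond a b s.
  by move=> h; apply/condP/lamP; rewrite (perm_mem perm_lam) mem_cat h orbT.
have alP s : s \in alpha -> cond c d s by move=> h; apply/condP/rhoP; rewrite mem_cat h.
have beP s : s \in beta -> cond c d s.
  by move=> h; apply/condP/rhoP; rewrite !mem_cat h orbT.
have gaP s : s \in gamma -> cond c d s.
  by move=> h; apply/condP/rhoP; rewrite !mem_cat h !orbT.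
have psh1 s : cond a b s -> pshape M s by apply: cond_psh; lia.
have psh2 s : cond c d s -> pshape M s by apply: cond_psh; lia.
pose XS := zip (zip as_ mu) alpha; pose ZS := zip (zip bs nu) beta.
have [X1 X2 X3] := map_zip3 sza szal; have [Z1 Z2 Z3] := map_zip3 szb szbe.
have le_as x : x \in as_ -> x <= a.
  by move=> h; rewrite -suma sumnE; exact: (@leq_big _ as_ id x h).
have le_bs x : x \in bs -> x <= b.
  by move=> h; rewrite -sumb sumnE; exact: (@leq_big _ bs id x h).
have XP x : x \in XS -> [/\ cond a b x.1.2, cond c d x.2, size x.1.2 <= x.1.1 & x.1.1 <= a].
  move=> xX; have [/muP h1 /alP h2 [i lti Ex]] := zip3P 0 [::] sza szal xX.
  split=> //; first by rewrite Ex; exact: lenmu.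
  by rewrite Ex; apply/le_as/mem_nth; rewrite sza.
have ZP x : x \in ZS -> [/\ cond a b x.1.2, cond c d x.2, nth 0 x.1.2 0 <= x.1.1 & x.1.1 <= b].
  move=> xX; have [/nuP h1 /beP h2 [i lti Ex]] := zip3P 0 [::] szb szbe xX.
  split=> //; first by rewrite Ex; exact: fstnu.
  by rewrite Ex; apply/le_bs/mem_nth; rewrite szb.
pose f1 (x : nat * seq nat * seq nat) := pjoin (padd (box x.1.1 d) x.1.2) x.2.
pose f2 (x : nat * seq nat * seq nat) := padd (pjoin (box c x.1.1) x.1.2) x.2.
have f1P x : x \in XS -> [/\ cond (a + c) (b + d) (f1 x),
    toptn M (f1 x) = corner x.1.1 d (toptn M x.1.2) (toptn M x.2) &
    sumn (f1 x) = sumn x.1.2 + x.1.1 * d + sumn x.2].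
  move=> xX; have [[p1 s1 n1] [p2 s2 n2] lx xa] := XP x xX.
  have [nE pE sE] := condition_above d0 p1 p2 lx n2.
  have cf : cond (a + c) (b + d) (f1 x).
    split=> //; first by rewrite sE; lia.
    by rewrite nE; case: ifP; rewrite ?sub0n; lia.
  have [||||||||E1 E2] := @toptn_corner M x.1.1 d x.1.2 x.2 (f1 x) => //; try lia.
  - exact: psh1.
  - exact: psh2.
  - exact: cond_psh cf.
have f2P x : x \in ZS -> [/\ cond (a + c) (b + d) (f2 x),
    toptn M (f2 x) = corner c x.1.1 (toptn M x.2) (toptn M x.1.2) &
    sumn (f2 x) = sumn x.2 + c * x.1.1 + sumn x.1.2].
  move=> xX; have [[p1 s1 n1] [p2 s2 n2] lx xa] := ZP x xX.
  have [nE pE sE] := condition_left p2 p1 s2 lx.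
  have cf : cond (a + c) (b + d) (f2 x).
    split=> //; first by apply: leq_trans sE _; lia.
    by rewrite nE c0; lia.
  have [||||||||E1 E2] := @toptn_corner M c x.1.1 x.2 x.1.2 (f2 x) => //; try lia.
  - exact: psh2.
  - exact: psh1.
  - exact: cond_psh cf.
have compE : compose c d as_ bs mu nu alpha beta gamma
    = [seq f1 x | x <- XS] ++ [seq f2 x | x <- ZS] ++ gamma by [].
have condC s : s \in compose c d as_ bs mu nu alpha beta gamma -> cond (a + c) (b + d) s.
  rewrite compE !mem_cat => /or3P[/mapP[x /f1P[? _ _] ->]|/mapP[x /f2P[? _ _] ->]|/gaP[? ? ?]] //.
  by split=> //; lia.
have lam_sum' : sumn (map psize mu) + sumn (map psize nu) = a * b.
  by rewrite -sumn_cat -map_cat -lam_sum; apply/perm_sumn/perm_map; rewrite perm_sym.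
have rho_sum' : sumn (map psize alpha) + sumn (map psize beta) + sumn (map psize gamma) = c * d.
  by rewrite -rho_sum !map_cat !sumn_cat addnA.
have SX1 : sumn as_ = \sum_(x <- XS) x.1.1 by rewrite -{1}X1 sumnE big_map.
have SX2 : sumn (map psize mu) = \sum_(x <- XS) sumn x.1.2 by rewrite -{1}X2 sumnE !big_map.
have SX3 : sumn (map psize alpha) = \sum_(x <- XS) sumn x.2 by rewrite -{1}X3 sumnE !big_map.
have SZ1 : sumn bs = \sum_(x <- ZS) x.1.1 by rewrite -{1}Z1 sumnE big_map.
have SZ2 : sumn (map psize nu) = \sum_(x <- ZS) sumn x.1.2 by rewrite -{1}Z2 sumnE !big_map.
have SZ3 : sumn (map psize beta) = \sum_(x <- ZS) sumn x.2 by rewrite -{1}Z3 sumnE !big_map.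
have sum_f1 : sumn (map psize [seq f1 x | x <- XS])
    = sumn (map psize mu) + a * d + sumn (map psize alpha).
  rewrite SX2 SX3 -suma SX1 big_distrl -!big_split /= sumnE !big_map.
  by apply: eq_big_seq => x /f1P[].
have sum_f2 : sumn (map psize [seq f2 x | x <- ZS])
    = sumn (map psize beta) + c * b + sumn (map psize nu).
  rewrite SZ2 SZ3 -sumb SZ1 big_distrr -!big_split /= sumnE !big_map.
  by apply: eq_big_seq => x /f2P[].
have comp_sum : sumn (map psize (compose c d as_ bs mu nu alpha beta gamma)) = (a + c) * (b + d).
  by rewrite compE !map_cat !sumn_cat sum_f1 sum_f2; lia.
split.
  apply/andP; split; last exact/eqP.
  by apply/allP => s /condC[ps szs s0]; rewrite ps subp_box // szs.
rewrite (@delta_lrc M) //; last first.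
  by move=> s /condC; exact: cond_psh.
rewrite (@delta_lrc M a b lam) //; [|lia|lia|nia|]; last first.
  by move=> s /lamP/condP/psh1.
rewrite (@delta_lrc M c d) //; [|lia|lia|nia|]; last first.
  by move=> s /rhoP/condP/psh2.
pose X := [seq (x.1.1, toptn M x.1.2, toptn M x.2) | x <- XS].
(* A condition [gamma^k] is a composed one with [b_j = 0] and empty [nu^j]: the corner with a
   rectangle of width 0 and [gamma^k] to its right. *)
pose Z := [seq (x.1.1, toptn M x.1.2, toptn M x.2) | x <- ZS]
          ++ [seq (0, ptn0 M, toptn M s) | s <- gamma].
have rowE x y s k : x <= M -> y <= M -> cond x y s ->
    (toptn M s 0 <= y) && (toptn M s k == 0) = (nth 0 s k == 0).
  by move=> xM yM cs; have [_ _ s0] := cs; rewrite !toptnE ?s0 //; exact: cond_psh cs.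
have nth_len s k : size s <= k -> nth 0 s k == 0 by move=> le; rewrite nth_default.
have hX z : z \in X -> [&& z.1.2 z.1.1 == 0, z.1.2 0 <= b, z.2 0 <= d & z.2 c == 0].
  move=> /mapP[x /XP[h1 h2 lx _] ->] /=; rewrite (@rowE c d) //; try lia.
  rewrite andbA andbC [X in _ && X]andbC (@rowE a b) //; try lia.
  by rewrite !nth_len //; case: h2.
have hZ z : z \in Z -> [&& z.1.2 0 <= z.1.1, z.1.2 a == 0, z.2 0 <= d & z.2 c == 0].
  rewrite mem_cat => /orP[/mapP[x /ZP[h1 h2 lx _] ->]|/mapP[s /gaP h ->]] /=.
    rewrite (@rowE c d) //; try lia.
    have [_ l1 _] := h1; have [_ l2 _] := h2.
    by rewrite !(toptnE _ (psh1 _ h1)) lx !nth_len.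
  by rewrite !ptn0E /= (@rowE c d) //; [apply: nth_len; case: h|lia|lia].
have sz1 s : cond a b s -> psz (toptn M s) = sumn s by move/psh1/psz_toptn.
have sz2 s : cond c d s -> psz (toptn M s) = sumn s by move/psh2/psz_toptn.
have EX1 : \sum_(x <- XS) psz (toptn M x.1.2) = sumn (map psize mu).
  by rewrite SX2; apply: eq_big_seq => x /XP[/sz1].
have EX2 : \sum_(x <- XS) psz (toptn M x.2) = sumn (map psize alpha).
  by rewrite SX3; apply: eq_big_seq => x /XP[_ /sz2].
have EZ1 : \sum_(x <- ZS) psz (toptn M x.1.2) = sumn (map psize nu).
  by rewrite SZ2; apply: eq_big_seq => x /ZP[/sz1].
have EZ2 : \sum_(x <- ZS) psz (toptn M x.2) = sumn (map psize beta).
  by rewrite SZ3; apply: eq_big_seq => x /ZP[_ /sz2].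
have EG : \sum_(s <- gamma) psz (toptn M s) = sumn (map psize gamma).
  by rewrite sumnE big_map; apply: eq_big_seq => s /gaP/sz2.
have sumsX : \sum_(z <- X) z.1.1 = a by rewrite big_map /= -SX1.
have sumsZ : \sum_(z <- Z) z.1.1 = b by rewrite big_cat !big_map /= -SZ1 big1_eq addn0.
have sums1 : \sum_(z <- X) psz z.1.2 + \sum_(z <- Z) psz z.1.2 = a * b.
  by rewrite big_cat !big_map /= EX1 EZ1 psz0 big1_eq addn0.
have sums2 : \sum_(z <- X) psz z.2 + \sum_(z <- Z) psz z.2 = c * d.
  by rewrite big_cat !big_map /= EX2 EZ2 EG addnA.
have compE' : map (toptn M) (compose c d as_ bs mu nu alpha beta gamma)
    = [seq corner z.1.1 d z.1.2 z.2 | z <- X] ++ [seq corner c z.1.1 z.2 z.1.2 | z <- Z].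
  rewrite compE /X /Z !map_cat -!map_comp; congr (_ ++ (_ ++ _)).
  - by apply/eq_in_map => x /f1P[].
  - by apply/eq_in_map => x /f2P[].
  apply/eq_in_map => s /gaP cs /=; have [_ szs _] := cs; have ps := psh2 _ cs.
  have cM : c <= M by lia.
  have s_len : toptn M s c = 0 by rewrite toptnE // nth_default.
  apply: ptnP => i _; rewrite cornerE ?ptn0E ?prow_max //.
  by case: ltnP => // le; have := prow_dec (toptn M s) le; lia.
(* The empty partitions introduced by [gamma] contribute the factor 1, which [lrc_cat0] removes. *)
have lamE : map (toptn M) mu ++ map (toptn M) nu ++ [seq ptn0 M | _ <- gamma]
    = [seq z.1.2 | z <- X] ++ [seq z.1.2 | z <- Z].
  by rewrite /X /Z map_cat -!map_comp -{1}X2 -{1}Z2 -!map_comp.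
have rhoE : map (toptn M) (alpha ++ beta ++ gamma) = [seq z.2 | z <- X] ++ [seq z.2 | z <- Z].
  by rewrite /X /Z !map_cat -!map_comp -{1}X3 -{1}Z3 -!map_comp.
rewrite compE' lrc_compose // -lamE -rhoE catA lrc_cat0 -map_cat.
by rewrite (perm_lrc (perm_map (toptn M) perm_lam)).
Qed.
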